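(* Let $\mathcal P$ be a locally trivial quantum principal fibre bundle whose Hopf algebra $H$ has bijective antipode, and let $\Gamma(\mathcal P)$ be a differential structure on $\mathcal P$ for which the differential algebra $\Gamma(H)$ is the universal one. Then all left (right) connections on $\mathcal P$ are covariant: for every left (right) connection with covariant derivative $D_{l}$ ($D_r$) and every left (right) gauge transformation $\alpha_{l}$ ($\alpha_r$) on $\mathcal P$, the map $D'_{l,r}=\alpha_{l,r}\circ D_{l,r}\circ\alpha_{l,r}^{-1}$ is the left (right) covariant derivative of a left (right) connection.
   Context: Bundles. Algebras are unital and associative over $\mathbb C$. A covering of an algebra $B$ is a finite family $(J_i)_{i\in I}$ of two-sided ideals with $\bigcap_i J_i=0$; $B_i=B/J_i$, $B_{ij}=B/(J_i+J_j)$, with quotient maps $\pi_i:B\to B_i$, $\pi^i_j:B_i\to B_{ij}$. It is complete if $b\mapsto(\pi_i(b))_i$ maps $B$ onto $\{(b_i)\mid \pi^i_j(b_i)=\pi^j_i(b_j)\}$. A locally trivial quantum principal fibre bundle consists of an algebra $B$ with complete covering $(J_i)_{i\in I}$, a Hopf algebra $H$, a right $H$-comodule algebra $\mathcal P$ with coaction $\Delta_{\mathcal P}$, an injective homomorphism $\iota:B\to\mathcal P$, and surjective homomorphisms $\chi_i:\mathcal P\to B_i\otimes H$ with $\chi_i(\iota(b))=\pi_i(b)\otimes 1$, $(\chi_i\otimes id)\circ\Delta_{\mathcal P}=(id\otimes\Delta)\circ\chi_i$, and $(\ker\chi_i)_i$ a complete covering of $\mathcal P$. Gauge transformations. A left (right)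 gauge transformation on $B_i\otimes H$ is an isomorphism $\alpha$ of left (right) $(B_i\otimes1)$-modules with $(\alpha\otimes id)(id\otimes\Delta)=(id\otimes\Delta)\alpha$ and $\alpha(a\otimes1)=a\otimes1$. A left (right) gauge transformation on $\mathcal P$ is an isomorphism $\alpha:\mathcal P\to\mathcal P$ of left (right) $\iota(B)$-modules such that for all $i$ there is a left (right) gauge transformation $\alpha_i$ on $B_i\otimes H$ with $\chi_i\circ\alpha=\alpha_i\circ\chi_i$. There are unique linear maps $g_{\alpha}:H\to\mathcal P$ with $\alpha_l(f)=\sum f_0g_{\alpha_l}(f_1)$ (left), $\alpha_r(f)=\sum g_{\alpha_r}(f_1)f_0$ (right), where $\Delta_{\mathcal P}(f)=\sum f_0\otimes f_1$. Differential structures. A differential algebra $\Gamma(A)$ over an algebra $A$ is a differential graded algebra with $\Gamma^0(A)=A$ generated by $A$ and $dA$, i.e. a quotient of the universal one $\Omega(A)$. Given differential algebras $\Gamma(B_i)$ and a right covariant differential algebra $\Gamma(H)$, let $J_i(\mathcal P)$ be the kernel of the map $\Omega(\mathcal P)\to\Gamma(B_i)\hat\otimes\Gamma(H)$ (graded tensor product) induced by $\chi_i$. The differential structure on $\mathcal P$ is $\Gamma(\mathcal P)=\Omega(\mathcal P)/\bigcap_iJ_i(\mathcal P)$. Let $\chi_{i_\Gamma}:\Gamma(\mathcal P)\to\Gamma(B_i)\hat\otimes\Gamma(H)$ be the induced surjections, $K_i$ their kernels. $\Gamma_c(\mathcal P)$ is the algebra of families $(\gamma_i)_i$, $\gamma_i\in\Gamma(B_i)\hat\otimes\Gamma(H)\cong\Gamma(\mathcal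 P)/K_i$, such that $\gamma_i,\gamma_j$ have equal image in $\Gamma(\mathcal P)/(K_i+K_j)$; it is a differential graded algebra containing $\Gamma(\mathcal P)$, $\Gamma^0_c(\mathcal P)=\mathcal P$, and $\chi_{i_\Gamma}$ extends to it as $i$-th projection. $hor\,\Gamma_c(\mathcal P)=\{\gamma\mid\chi_{i_\Gamma}(\gamma)\in\Gamma(B_i)\hat\otimes H\ \forall i\}$. The coaction $\Delta_{\mathcal P}$ extends to a right coaction $\gamma\mapsto\sum\gamma_0\otimes\gamma_1$ on $\Gamma_c(\mathcal P)$ (locally induced by the right coactions on $H$ and $\Gamma(H)$). $\Gamma_m(B)=\{\gamma\in\Gamma_c(\mathcal P)\mid\chi_{i_\Gamma}(\gamma)\in\Gamma(B_i)\hat\otimes1\ \forall i\}$. Gauge transformations act on $hor\,\Gamma_c(\mathcal P)$ by $\alpha_l(\gamma)=\sum\gamma_0g_{\alpha_l}(\gamma_1)$, $\alpha_r(\gamma)=\sum g_{\alpha_r}(\gamma_1)\gamma_0$. Covariant derivatives and connections. A left (right) covariant derivative is a linear map $D$ of degree $1$ on $hor\,\Gamma_c(\mathcal P)$ with $D(1)=0$, commuting with the coaction, $D(\ker\chi_{i_\Gamma}\cap hor\,\Gamma_c(\mathcal P))\subset\ker\chi_{i_\Gamma}$, and $D(\rho\gamma)=(d\rho)\gamma+(-1)^n\rho D(\gamma)$ for $\rho\in\Gamma^n_m(B)$ (left), respectively $D(\gamma\rho)=D(\gamma)\rho+(-1)^n\gamma\,d\rho$ for $\gamma$ of degree $n$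 and $\rho\in\Gamma_m(B)$ (right). A left (right) connection is given by a left (right) $\mathcal P$-module projection $hor_{l}$ ($hor_r$) of one-forms $\Gamma^1_c(\mathcal P)$ onto the horizontal one-forms, commuting with the coaction and mapping each $\ker\chi_{i_\Gamma}$ into itself. The covariant derivative of the connection is $D_{l,r}=hor_{l,r}\circ d$, i.e. the left (right) covariant derivative on $hor\,\Gamma_c(\mathcal P)$ (uniquely determined by its restriction to $\mathcal P$) with $D_{l,r}(f)=hor_{l,r}(df)$ for $f\in\mathcal P$. *)

(* Defs.v *)
From HB Require Import structures.
From mathcomp Require Import all_boot all_order all_algebra.
From mathcomp Require Import boolp reals complex.

Set Implicit Arguments.
Unset Strict Implicit.
Unset Printing Implicit Defensive.
Import GRing.Theory.
Local Open Scope ring_scope.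
Local Open Scope quotient_scope.

Section LinearFunctions.
Variables (K : fieldType) (V W : lmodType K) (f : V -> W).
Hypothesis fL : linear f.
Lemma lin0 : f 0 = 0.
Proof. by have := fL (-1) 0 0; rewrite scaler0 addr0 scaleN1r addNr. Qed.
Lemma linD x y : f (x + y) = f x + f y.
Proof. by have := fL 1 x y; rewrite !scale1r. Qed.
Lemma linZ k x : f (k *: x) = k *: f x.
Proof. by have := fL k x 0; rewrite lin0 !addr0. Qed.
Lemma linN x : f (- x) = - f x.
Proof. by rewrite -!scaleN1r linZ. Qed.
Lemma linB x y : f (x - y) = f x - f y.
Proof. by rewrite linD linN. Qed.
Lemma lin_sum (I : Type) (r : seq I) (P : pred I) (F : I -> V) :
  f (\sum_(i <- r | P i) F i) = \sum_(i <- r | P i) f (F i).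
Proof.
elim: r => [|i r IH]; first by rewrite !big_nil lin0.
by rewrite !big_cons; case: ifP => _; rewrite ?linD IH.
Qed.
End LinearFunctions.

(* MathComp's algType excludes the zero ring, which does occur here (J_i and,
   more commonly, J_i + J_j may be everything), and its hierarchy leaves no room
   for a structure joining pzRingType and lmodType; hence the bespoke mixin. *)
HB.mixin Record isUAlg (K : fieldType) A of GRing.Lmodule K A := {
  amul : A -> A -> A;
  aone : A;
  amulA : associative amul;
  amul1l : left_id aone amul;
  amul1r : right_id aone amul;
  amulDl : left_distributive amul +%R;
  amulDr : right_distributive amul +%R;
  amulZl : forall (k : K) (x y : A), amul (k *: x) y = k *: amul x y;
  amulZr : forall (k : K) (x y : A), amul x (k *: y) = k *: amul x y }.
#[short(type="ualgType")]
HB.structure Definition UAlg (K : fieldType) := {A of isUAlg K A & GRing.Lmodule K A}.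

Notation "x ** y" := (amul x y) (at level 40, left associativity) : ring_scope.
Notation "\1" := aone : ring_scope.

Section UAlgTheory.
Variables (K : fieldType) (A : ualgType K).
Implicit Types x y z : A.
Lemma amul_linl y : linear (fun x => x ** y).
Proof. by move=> k x z; rewrite amulDl amulZl. Qed.
Lemma amul_linr x : linear (amul x).
Proof. by move=> k y z; rewrite amulDr amulZr. Qed.
Lemma amul0l x : 0 ** x = 0.
Proof. exact: lin0 (amul_linl x). Qed.
Lemma amul0r x : x ** 0 = 0.
Proof. exact: lin0 (amul_linr x). Qed.
Lemma amulNl x y : (- x) ** y = - (x ** y).
Proof. by rewrite -scaleN1r amulZl scaleN1r. Qed.
Lemma amulNr x y : x ** (- y) = - (x ** y).
Proof. by rewrite -scaleN1r amulZr scaleN1r. Qed.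
Lemma amulBl x y z : (x - y) ** z = x ** z - y ** z.
Proof. by rewrite amulDl amulNl. Qed.
Lemma amulBr x y z : x ** (y - z) = x ** y - x ** z.
Proof. by rewrite amulDr amulNr. Qed.
End UAlgTheory.

Record alghom (K : fieldType) (A B : ualgType K) := AlgHom {
  alghom_fun :> A -> B;
  alghom_lin : linear alghom_fun;
  alghom_mul : {morph alghom_fun : x y / x ** y};
  alghom_one : alghom_fun \1 = \1 }.

Definition is_ideal (K : fieldType) (A : ualgType K) (S : A -> Prop) : Prop :=
  [/\ S 0, forall k x y, S x -> S y -> S (k *: x + y),
      forall a x, S x -> S (a ** x) & forall a x, S x -> S (x ** a)].

Record ideal (K : fieldType) (A : ualgType K) := Ideal {
  ideal_set :> A -> Prop;
  idealP : is_ideal ideal_set }.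

Section IdealTheory.
Variables (K : fieldType) (A : ualgType K).
Implicit Type J : ideal A.

Lemma ideal0 J : J 0.
Proof. by case: (idealP J). Qed.
Lemma ideal_lin J k x y : J x -> J y -> J (k *: x + y).
Proof. by case: (idealP J) => _ h _ _; apply: h. Qed.
Lemma idealMl J a x : J x -> J (a ** x).
Proof. by case: (idealP J) => _ _ h _; apply: h. Qed.
Lemma idealMr J a x : J x -> J (x ** a).
Proof. by case: (idealP J) => _ _ _ h; apply: h. Qed.
Lemma idealD J x y : J x -> J y -> J (x + y).
Proof. by move=> Jx Jy; rewrite -[x]scale1r; apply: ideal_lin. Qed.
Lemma idealZ J k x : J x -> J (k *: x).
Proof. by move=> Jx; rewrite -[_ *: _]addr0; apply: ideal_lin => //; apply: ideal0. Qed.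
Lemma idealN J x : J x -> J (- x).
Proof. by move=> Jx; rewrite -scaleN1r; apply: idealZ. Qed.
Lemma idealB J x y : J x -> J y -> J (x - y).
Proof. by move=> Jx Jy; apply: idealD => //; apply: idealN. Qed.

Definition ker_set (B : ualgType K) (f : alghom A B) (x : A) : Prop := f x = 0.
Lemma ker_ideal_subproof (B : ualgType K) (f : alghom A B) : is_ideal (ker_set f).
Proof.
rewrite /ker_set; split=> [|k x y fx fy|a x fx|a x fx].
- exact: lin0 (alghom_lin f).
- by rewrite (alghom_lin f) fx fy scaler0 addr0.
- by rewrite alghom_mul fx amul0r.
- by rewrite alghom_mul fx amul0l.
Qed.
Definition ker_ideal (B : ualgType K) (f : alghom A B) : ideal A :=
  Ideal (ker_ideal_subproof f).

Definition sum_set J J' (x : A) : Prop := exists u v, [/\ J u, J' v & x = u + v].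
Lemma sum_ideal_subproof J J' : is_ideal (sum_set J J').
Proof.
split.
- by exists 0, 0; split; rewrite ?addr0 //; apply: ideal0.
- move=> k x y [u [v [Ju Jv ->]]] [u' [v' [Ju' Jv' ->]]].
  exists (k *: u + u'), (k *: v + v'); split; try exact: ideal_lin.
  by rewrite scalerDr addrACA.
- move=> a x [u [v [Ju Jv ->]]]; exists (a ** u), (a ** v).
  by split; rewrite ?amulDr //; apply: idealMl.
- move=> a x [u [v [Ju Jv ->]]]; exists (u ** a), (v ** a).
  by split; rewrite ?amulDl //; apply: idealMr.
Qed.
Definition sum_ideal J J' : ideal A :=
  Ideal (sum_ideal_subproof J J').

Definition cap_set (I : Type) (J : I -> ideal A) (x : A) : Prop := forall i, J i x.
Lemma cap_ideal_subproof (I : Type) (J : I -> ideal A) :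
  is_ideal (cap_set J).
Proof.
split=> [i|k x y Jx Jy i|a x Jx i|a x Jx i].
- exact: ideal0.
- exact: ideal_lin.
- exact: idealMl.
- exact: idealMr.
Qed.
Definition cap_ideal (I : Type) (J : I -> ideal A) : ideal A :=
  Ideal (cap_ideal_subproof J).
End IdealTheory.

Section QuotientAlgebra.
Variables (K : fieldType) (A : ualgType K) (J : ideal A).

Definition qrel (x y : A) : bool := `[< J (x - y) >].
Lemma qrel_refl : reflexive qrel.
Proof. by move=> x; apply/asboolP; rewrite subrr; apply: ideal0. Qed.
Lemma qrel_sym : symmetric qrel.
Proof.
by move=> x y; apply/asboolP/asboolP => h; rewrite -opprB; apply: idealN.
Qed.
Lemma qrel_trans : transitive qrel.
Proof.
move=> y x z /asboolP h /asboolP h'; apply/asboolP.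
by rewrite -(subrK y x) -addrA; apply: idealD.
Qed.
Canonical qrel_equiv := EquivRel qrel qrel_refl qrel_sym qrel_trans.

Definition quotient : Type := {eq_quot qrel_equiv}.
HB.instance Definition _ := Choice.on quotient.
HB.instance Definition _ := EqQuotient.on quotient.

Definition qproj (x : A) : quotient := \pi_quotient x.

Lemma qprojP x y : qproj x = qproj y <-> J (x - y).
Proof.
split=> [/eqP|h]; first by rewrite /qproj eqmodE => /asboolP.
by apply/eqP; rewrite /qproj eqmodE; apply/asboolP.
Qed.
Lemma qprojK (x : quotient) : qproj (repr x) = x.
Proof. exact: reprK. Qed.
Lemma repr_qproj (x : A) : J (repr (qproj x) - x).
Proof. by apply/qprojP; rewrite qprojK. Qed.
Lemma quotP (x : quotient) : exists a, x = qproj a.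
Proof. by exists (repr x); rewrite qprojK. Qed.

Definition qadd (x y : quotient) := qproj (repr x + repr y).
Definition qopp (x : quotient) := qproj (- repr x).
Definition qscale (k : K) (x : quotient) := qproj (k *: repr x).
Definition qmul (x y : quotient) := qproj (repr x ** repr y).

Lemma qaddE a b : qadd (qproj a) (qproj b) = qproj (a + b).
Proof. by apply/qprojP; rewrite opprD addrACA; apply: idealD; apply: repr_qproj. Qed.
Lemma qoppE a : qopp (qproj a) = qproj (- a).
Proof. by apply/qprojP; rewrite -opprD; apply: idealN; apply: repr_qproj. Qed.
Lemma qscaleE k a : qscale k (qproj a) = qproj (k *: a).
Proof. by apply/qprojP; rewrite -scalerBr; apply: idealZ; apply: repr_qproj. Qed.
Lemma qmulE a b : qmul (qproj a) (qproj b) = qproj (a ** b).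
Proof.
apply/qprojP; set a' := repr _; set b' := repr _.
rewrite -(subrK (a' ** b) (a' ** b')) -addrA -amulBr -amulBl.
by apply: idealD; [apply: idealMl | apply: idealMr]; apply: repr_qproj.
Qed.

Lemma qaddA : associative qadd.
Proof.
move=> x y z; case: (quotP x) (quotP y) (quotP z) => a -> [b ->] [c ->].
by rewrite !qaddE addrA.
Qed.
Lemma qaddC : commutative qadd.
Proof. by move=> x y; case: (quotP x) (quotP y) => a -> [b ->]; rewrite !qaddE addrC. Qed.
Lemma qadd0 : left_id (qproj 0) qadd.
Proof. by move=> x; case: (quotP x) => a ->; rewrite qaddE add0r. Qed.
Lemma qaddN : left_inverse (qproj 0) qopp qadd.
Proof. by move=> x; case: (quotP x) => a ->; rewrite qoppE qaddE addNr. Qed.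
HB.instance Definition _ := GRing.isZmodule.Build quotient qaddA qaddC qadd0 qaddN.

Lemma qmulA : associative qmul.
Proof.
move=> x y z; case: (quotP x) (quotP y) (quotP z) => a -> [b ->] [c ->].
by rewrite !qmulE amulA.
Qed.
Lemma qmul1l : left_id (qproj \1) qmul.
Proof. by move=> x; case: (quotP x) => a ->; rewrite qmulE amul1l. Qed.
Lemma qmul1r : right_id (qproj \1) qmul.
Proof. by move=> x; case: (quotP x) => a ->; rewrite qmulE amul1r. Qed.
Lemma qmulDl : left_distributive qmul +%R.
Proof.
move=> x y z; case: (quotP x) (quotP y) (quotP z) => a -> [b ->] [c ->].
by rewrite /GRing.add /= !(qaddE, qmulE) amulDl.
Qed.
Lemma qmulDr : right_distributive qmul +%R.
Proof.
move=> x y z; case: (quotP x) (quotP y) (quotP z) => a -> [b ->] [c ->].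
by rewrite /GRing.add /= !(qaddE, qmulE) amulDr.
Qed.
Lemma qscaleA a b x : qscale a (qscale b x) = qscale (a * b) x.
Proof. by case: (quotP x) => c ->; rewrite !qscaleE scalerA. Qed.
Lemma qscale1 : left_id 1 qscale.
Proof. by move=> x; case: (quotP x) => a ->; rewrite qscaleE scale1r. Qed.
Lemma qscaleDr : right_distributive qscale +%R.
Proof.
move=> k x y; case: (quotP x) (quotP y) => a -> [b ->].
by rewrite /GRing.add /= !(qaddE, qscaleE) scalerDr.
Qed.
Lemma qscaleDl x : {morph qscale^~ x : a b / a + b}.
Proof.
move=> a b; case: (quotP x) => c ->.
by rewrite [RHS]/GRing.add /= !(qaddE, qscaleE) scalerDl.
Qed.
HB.instance Definition _ := GRing.Zmodule_isLmodule.Build K quotient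
  qscaleA qscale1 qscaleDr qscaleDl.

Lemma qmulZl (k : K) x y : qmul (k *: x) y = k *: qmul x y.
Proof.
case: (quotP x) (quotP y) => a -> [b ->].
by rewrite /GRing.scale /= !(qmulE, qscaleE) amulZl.
Qed.
Lemma qmulZr (k : K) x y : qmul x (k *: y) = k *: qmul x y.
Proof.
case: (quotP x) (quotP y) => a -> [b ->].
by rewrite /GRing.scale /= !(qmulE, qscaleE) amulZr.
Qed.
HB.instance Definition _ := isUAlg.Build K quotient
  qmulA qmul1l qmul1r qmulDl qmulDr qmulZl qmulZr.

Lemma qproj_lin : linear qproj.
Proof. by move=> k x y; rewrite /GRing.add /GRing.scale /= qscaleE qaddE. Qed.
Lemma qproj_mul : {morph qproj : x y / x ** y}.
Proof. by move=> x y; rewrite [RHS]/amul /= qmulE. Qed.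
Definition qproj_hom : alghom A quotient :=
  AlgHom qproj_lin qproj_mul (erefl : qproj \1 = \1).
End QuotientAlgebra.

(* The tensor product over K: formal sums of pairs modulo the congruence
   generated by bilinearity. *)
Section TensorProduct.
Variables (K : fieldType) (V W : lmodType K).

Inductive tcong : seq (V * W) -> seq (V * W) -> Prop :=
| tcong_refl s : tcong s s
| tcong_sym s t : tcong s t -> tcong t s
| tcong_trans s t u : tcong s t -> tcong t u -> tcong s u
| tcong_cat s s' t t' : tcong s s' -> tcong t t' -> tcong (s ++ t) (s' ++ t')
| tcong_comm s t : tcong (s ++ t) (t ++ s)
| tcong_zero w : tcong [:: (0, w)] [::]
| tcong_addl v v' w : tcong [:: (v + v', w)] [:: (v, w); (v', w)]
| tcong_addr v w w' : tcong [:: (v, w + w')] [:: (v, w); (v, w')]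
| tcong_scale k v w : tcong [:: (k *: v, w)] [:: (v, k *: w)].

Definition tcongb (s t : seq (V * W)) : bool := `[< tcong s t >].
Lemma tcongb_refl : reflexive tcongb.
Proof. by move=> s; apply/asboolP; apply: tcong_refl. Qed.
Lemma tcongb_sym : symmetric tcongb.
Proof. by move=> s t; apply/asboolP/asboolP => h; apply: tcong_sym. Qed.
Lemma tcongb_trans : transitive tcongb.
Proof.
by move=> t s u /asboolP h /asboolP h'; apply/asboolP; apply: tcong_trans h h'.
Qed.
Canonical tcong_equiv := EquivRel tcongb tcongb_refl tcongb_sym tcongb_trans.

Definition tensor : Type := {eq_quot tcong_equiv}.
HB.instance Definition _ := Choice.on tensor.
HB.instance Definition _ := EqQuotient.on tensor.

Definition tcls (s : seq (V * W)) : tensor := \pi_tensor s.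

Lemma tclsP s t : tcls s = tcls t <-> tcong s t.
Proof.
split=> [/eqP|h]; first by rewrite /tcls eqmodE => /asboolP.
by apply/eqP; rewrite /tcls eqmodE; apply/asboolP.
Qed.
Lemma tclsK (x : tensor) : tcls (repr x) = x.
Proof. exact: reprK. Qed.
Lemma repr_tcls s : tcong (repr (tcls s)) s.
Proof. by apply/tclsP; rewrite tclsK. Qed.
Lemma tensP (x : tensor) : exists s, x = tcls s.
Proof. by exists (repr x); rewrite tclsK. Qed.

Definition tscales (k : K) (s : seq (V * W)) := [seq (k *: p.1, p.2) | p <- s].
Definition tadd (x y : tensor) := tcls (repr x ++ repr y).
Definition tscale (k : K) (x : tensor) := tcls (tscales k (repr x)).
Definition topp (x : tensor) := tscale (-1) x.

Lemma tscales_cong k s t : tcong s t -> tcong (tscales k s) (tscales k t).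
Proof.
elim=> {s t} [s|s t _ h|s t u _ h _ h'|s s' t t' _ h _ h'|s t|w|v v' w|v w w'|l v w].
- exact: tcong_refl.
- exact: tcong_sym.
- exact: tcong_trans h h'.
- by rewrite /tscales !map_cat; apply: tcong_cat.
- by rewrite /tscales !map_cat; apply: tcong_comm.
- by rewrite /tscales /= scaler0; apply: tcong_zero.
- by rewrite /tscales /= scalerDr; apply: tcong_addl.
- exact: tcong_addr.
- rewrite /tscales /=; apply: tcong_trans (tcong_scale _ _ _) _.
  apply: tcong_trans (tcong_scale _ _ _) _.
  apply: tcong_sym; apply: tcong_trans (tcong_scale _ _ _) _.
  by rewrite !scalerA mulrC; apply: tcong_refl.
Qed.

Lemma taddE s t : tadd (tcls s) (tcls t) = tcls (s ++ t).
Proof. by apply/tclsP; apply: tcong_cat; apply: repr_tcls. Qed.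
Lemma tscaleE k s : tscale k (tcls s) = tcls (tscales k s).
Proof. by apply/tclsP; apply: tscales_cong; apply: repr_tcls. Qed.

Lemma taddA : associative tadd.
Proof.
move=> x y z; case: (tensP x) (tensP y) (tensP z) => s -> [t ->] [u ->].
by rewrite !taddE catA.
Qed.
Lemma taddC : commutative tadd.
Proof.
move=> x y; case: (tensP x) (tensP y) => s -> [t ->].
by rewrite !taddE; apply/tclsP; apply: tcong_comm.
Qed.
Lemma tadd0 : left_id (tcls [::]) tadd.
Proof. by move=> x; case: (tensP x) => s ->; rewrite taddE. Qed.
Lemma tscale_pair (a b : K) s : tcong (tscales a s ++ tscales b s) (tscales (a + b) s).
Proof.
elim: s => [|[v w] s IH] /=; first exact: tcong_refl.
rewrite scalerDl.
apply: (@tcong_trans _ ([:: (a *: v, w); (b *: v, w)] ++ (tscales a s ++ tscales b s))).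
  rewrite -[_ :: (_ ++ _)]cat1s -[[:: _; _]]cat1s -catA.
  apply: tcong_cat; first exact: tcong_refl.
  rewrite -[_ :: tscales b s]cat1s !catA.
  by apply: tcong_cat; [apply: tcong_comm | apply: tcong_refl].
rewrite -[_ :: tscales _ _]cat1s; apply: tcong_cat; last exact: IH.
by apply: tcong_sym; apply: tcong_addl.
Qed.
Lemma tscale0s s : tcong (tscales 0 s) [::].
Proof.
elim: s => [|[v w] s IH] /=; first exact: tcong_refl.
rewrite -cat1s -[[::]]cats0 scale0r; apply: tcong_cat => //; exact: tcong_zero.
Qed.
Lemma tscales1 s : tscales 1 s = s.
Proof. by elim: s => //= -[v w] s ->; rewrite scale1r. Qed.
Lemma taddN : left_inverse (tcls [::]) topp tadd.
Proof.
move=> x; case: (tensP x) => s ->.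
rewrite /topp tscaleE -[in X in tadd _ X](tscales1 s) taddE; apply/tclsP.
by apply: tcong_trans (tscale_pair _ _ _) _; rewrite addNr; apply: tscale0s.
Qed.
HB.instance Definition _ := GRing.isZmodule.Build tensor taddA taddC tadd0 taddN.

Lemma tscaleA a b x : tscale a (tscale b x) = tscale (a * b) x.
Proof.
case: (tensP x) => s ->; rewrite !tscaleE /tscales -map_comp.
by congr tcls; apply: eq_map => p /=; rewrite scalerA.
Qed.
Lemma tscale1 : left_id 1 tscale.
Proof. by move=> x; case: (tensP x) => s ->; rewrite tscaleE tscales1. Qed.
Lemma tscaleDr : right_distributive tscale +%R.
Proof.
move=> k x y; case: (tensP x) (tensP y) => s -> [t ->].
by rewrite /GRing.add /= !(taddE, tscaleE) /tscales map_cat.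
Qed.
Lemma tscaleDl x : {morph tscale^~ x : a b / a + b}.
Proof.
move=> a b; case: (tensP x) => s ->.
rewrite [RHS]/GRing.add /= !(taddE, tscaleE).
by apply/tclsP; apply: tcong_sym; apply: tscale_pair.
Qed.
HB.instance Definition _ := GRing.Zmodule_isLmodule.Build K tensor
  tscaleA tscale1 tscaleDr tscaleDl.

Definition tens (v : V) (w : W) : tensor := tcls [:: (v, w)].

Lemma tens_linl w : linear (tens^~ w).
Proof.
move=> k v v'; rewrite /GRing.add /GRing.scale /= tscaleE taddE; apply/tclsP.
exact: tcong_addl.
Qed.
Lemma tens_linr v : linear (tens v).
Proof.
move=> k w w'; rewrite /GRing.add /GRing.scale /= tscaleE taddE; apply/tclsP.
apply: tcong_trans (tcong_addr _ _ _) _; rewrite -cat1s -[X in tcong _ X]cat1s.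
apply: tcong_cat; last exact: tcong_refl.
by apply: tcong_sym; apply: tcong_scale.
Qed.
Lemma tclsE s : tcls s = \sum_(p <- s) tens p.1 p.2.
Proof.
elim: s => [|[v w] s IH]; first by rewrite big_nil.
by rewrite big_cons -IH [RHS]/GRing.add /= taddE.
Qed.
Lemma tensE (x : tensor) : x = \sum_(p <- repr x) tens p.1 p.2.
Proof. by rewrite -tclsE tclsK. Qed.
Lemma tens_ind (P : tensor -> Prop) :
  P 0 -> (forall x y, P x -> P y -> P (x + y)) -> (forall v w, P (tens v w)) ->
  forall x, P x.
Proof.
by move=> P0 PD Pt x; rewrite [x]tensE; elim/big_ind: _ => // p _; apply: Pt.
Qed.
End TensorProduct.

Notation "v ⊗ w" := (tens v w) (at level 40, left associativity) : ring_scope.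

Section Lift.
Variables (K : fieldType) (V W U : lmodType K).

(* The linear map v ⊗ w |-> f v w, meaningful when f is bilinear. *)
Definition tlift (f : V -> W -> U) (x : tensor V W) : U :=
  \sum_(p <- repr x) f p.1 p.2.

Definition bilin (f : V -> W -> U) : Prop :=
  (forall w, linear (f^~ w)) /\ (forall v, linear (f v)).

Variables (f : V -> W -> U) (fB : bilin f).

Lemma tlift_cong s t : tcong s t ->
  \sum_(p <- s) f p.1 p.2 = \sum_(p <- t) f p.1 p.2.
Proof.
case: fB => fl fr.
elim=> {s t} [//|//|s t u _ -> _ -> //|s s' t t' _ h _ h'|s t|w|v v' w|v w w'|l v w].
- by rewrite !big_cat /= h h'.
- by rewrite !big_cat /= addrC.
- by rewrite big_seq1 big_nil (lin0 (fl w)).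
- by rewrite !big_cons !big_nil !addr0 (linD (fl w)).
- by rewrite !big_cons !big_nil !addr0 (linD (fr v)).
- by rewrite !big_seq1 (linZ (fl w)) (linZ (fr v)).
Qed.
Lemma tlift_tcls s : tlift f (tcls s) = \sum_(p <- s) f p.1 p.2.
Proof. by apply: tlift_cong; apply: repr_tcls. Qed.
Lemma tliftE v w : tlift f (v ⊗ w) = f v w.
Proof. by rewrite tlift_tcls big_seq1. Qed.
Lemma tlift_lin : linear (tlift f).
Proof.
move=> k x y; case: (tensP x) (tensP y) => s -> [t ->].
rewrite [X in tlift f X]/GRing.add /GRing.scale /= tscaleE taddE.
rewrite !tlift_tcls big_cat /= big_map; congr (_ + _).
apply: etrans (esym (scaler_sumr _ _ _ _)).
by apply: eq_bigr => p _; rewrite (linZ (fB.1 _)).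
Qed.
End Lift.

Lemma tens_eq_lin (K : fieldType) (V W U : lmodType K) (f g : tensor V W -> U) :
  linear f -> linear g -> (forall v w, f (v ⊗ w) = g (v ⊗ w)) -> f =1 g.
Proof.
move=> fL gL h; elim/tens_ind => [|x y hx hy|]; last exact: h.
  by rewrite (lin0 fL) (lin0 gL).
by rewrite (linD fL) (linD gL) hx hy.
Qed.

Section TensorMaps.
Variable (K : fieldType).
Implicit Types V W U : lmodType K.

Definition tmap V W V' W' (f : V -> V') (g : W -> W') : tensor V W -> tensor V' W' :=
  tlift (fun v w => f v ⊗ g w).

Lemma tmap_bilin V W V' W' (f : V -> V') (g : W -> W') :
  linear f -> linear g -> bilin (fun v w => f v ⊗ g w).
Proof.
move=> fL gL; split=> [w k v v'|v k w w'].
  by rewrite fL (tens_linl _ k).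
by rewrite gL (tens_linr _ k).
Qed.
Lemma tmapE V W V' W' (f : V -> V') (g : W -> W') v w :
  linear f -> linear g -> tmap f g (v ⊗ w) = f v ⊗ g w.
Proof. by move=> fL gL; apply/tliftE/tmap_bilin. Qed.
Lemma tmap_lin V W V' W' (f : V -> V') (g : W -> W') :
  linear f -> linear g -> linear (tmap f g).
Proof. by move=> fL gL; apply/tlift_lin/tmap_bilin. Qed.

(* v ⊗ (w ⊗ u) |-> (v ⊗ w) ⊗ u *)
Definition tassoc V W U : tensor V (tensor W U) -> tensor (tensor V W) U :=
  tlift (fun v => tlift (fun w u => v ⊗ w ⊗ u)).

Lemma tassocE V W U (v : V) (w : W) (u : U) : tassoc (v ⊗ (w ⊗ u)) = v ⊗ w ⊗ u.
Proof.
have B x : bilin (fun (w : W) (u : U) => (x : V) ⊗ w ⊗ u).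
  split=> [z k y y'|y k z z'].
    by rewrite (tens_linr x k) (tens_linl _ k).
  by rewrite (tens_linr _ k).
rewrite /tassoc tliftE ?tliftE //; split=> [t k x x'|x]; last exact: tlift_lin.
elim/tens_ind: t => [|t t' h h'|y z].
- by rewrite !(lin0 (tlift_lin (B _))) scaler0 addr0.
- by rewrite !(linD (tlift_lin (B _))) h h' scalerDr addrACA.
- by rewrite !tliftE // (tens_linl _ k) (tens_linl _ k).
Qed.
End TensorMaps.

(* The product (a ⊗ b)(c ⊗ d) = a c ⊗ b_0 d + a s(c) ⊗ b_1 d, where b_0 and b_1
   are the even and odd parts of b and s is the sign automorphism; both the plain
   tensor product algebra and the graded one are instances. *)
Section TwistedTensor.
Variables (K : fieldType) (A B : ualgType K).
Variables (s : A -> A) (e o : B -> B).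

Definition twmul_tens (a : A) (b : B) (c : A) (d : B) : tensor A B :=
  (a ** c) ⊗ (e b ** d) + (a ** s c) ⊗ (o b ** d).
Definition twmul (x y : tensor A B) : tensor A B :=
  tlift (fun a b => tlift (twmul_tens a b) y) x.

Hypothesis sL : linear s.
Hypothesis eL : linear e.
Hypothesis oL : linear o.
Hypothesis s1 : s \1 = \1.
Hypothesis sM : {morph s : x y / x ** y}.
Hypothesis sK : involutive s.
Hypothesis eoD : forall b, e b + o b = b.
Hypothesis e1 : e \1 = \1.
Hypothesis o1 : o \1 = 0.
Hypothesis eM : forall x y, e (x ** y) = e x ** e y + o x ** o y.
Hypothesis oM : forall x y, o (x ** y) = e x ** o y + o x ** e y.
Hypothesis eoK : forall x, [/\ e (e x) = e x, o (e x) = 0, o (o x) = o x & e (o x) = 0].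

Lemma twmul_tens_bilin a b : bilin (twmul_tens a b).
Proof.
rewrite /twmul_tens; split=> [d k c c'|c k d d'].
  rewrite !sL !amulDr !amulZr !(linD (tens_linl _)) !(linZ (tens_linl _)).
  by rewrite scalerDr addrACA.
rewrite !amulDr !amulZr !(linD (tens_linr _)) !(linZ (tens_linr _)).
by rewrite scalerDr addrACA.
Qed.
Lemma twmul_bilin y : bilin (fun a b => tlift (twmul_tens a b) y).
Proof.
split=> [b k a a'|a k b b'].
  elim/tens_ind: y => [|y y' h h'|c d].
  - by rewrite !(lin0 (tlift_lin (twmul_tens_bilin _ _))) scaler0 addr0.
  - rewrite !(linD (tlift_lin (twmul_tens_bilin _ _))) h h'.
    by rewrite scalerDr addrACA.
  - rewrite !(tliftE (twmul_tens_bilin _ _)) /twmul_tens.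
    rewrite !amulDl !amulZl !(linD (tens_linl _)) !(linZ (tens_linl _)).
    by rewrite scalerDr addrACA.
elim/tens_ind: y => [|y y' h h'|c d].
- by rewrite !(lin0 (tlift_lin (twmul_tens_bilin _ _))) scaler0 addr0.
- rewrite !(linD (tlift_lin (twmul_tens_bilin _ _))) h h'.
  by rewrite scalerDr addrACA.
- rewrite !(tliftE (twmul_tens_bilin _ _)) /twmul_tens.
  rewrite !(eL, oL) !amulDl !amulZl !(linD (tens_linr _)) !(linZ (tens_linr _)).
  by rewrite scalerDr addrACA.
Qed.
Lemma twmulE a b c d : twmul (a ⊗ b) (c ⊗ d) = twmul_tens a b c d.
Proof.
by rewrite /twmul (tliftE (twmul_bilin _)) (tliftE (twmul_tens_bilin _ _)).
Qed.
Lemma twmul_linl y : linear (twmul^~ y).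
Proof. exact: tlift_lin (twmul_bilin y). Qed.
Lemma twmul_linr x : linear (twmul x).
Proof.
move=> k y y'; elim/tens_ind: x => [|x x' h h'|a b].
- by rewrite !(lin0 (twmul_linl _)) scaler0 addr0.
- by rewrite !(linD (twmul_linl _)) h h' scalerDr addrACA.
- rewrite /twmul !(tliftE (twmul_bilin _)).
  exact: (tlift_lin (twmul_tens_bilin _ _)).
Qed.
Lemma twmulDl : left_distributive twmul +%R.
Proof. by move=> x x' y; rewrite (linD (twmul_linl y)). Qed.
Lemma twmulDr : right_distributive twmul +%R.
Proof. by move=> x y y'; rewrite (linD (twmul_linr x)). Qed.
Lemma twmulZl k x y : twmul (k *: x) y = k *: twmul x y.
Proof. exact: (linZ (twmul_linl y)). Qed.
Lemma twmulZr k x y : twmul x (k *: y) = k *: twmul x y.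
Proof. exact: (linZ (twmul_linr x)). Qed.
Lemma twmul1l : left_id (\1 ⊗ \1) twmul.
Proof.
move=> y; apply: (@tens_eq_lin _ _ _ _ (twmul (\1 ⊗ \1)) id) => [|//|c d].
  exact: twmul_linr.
by rewrite twmulE /twmul_tens e1 o1 amul0l (lin0 (tens_linr _)) addr0 !amul1l.
Qed.
Lemma twmul1r : right_id (\1 ⊗ \1) twmul.
Proof.
move=> y; apply: (@tens_eq_lin _ _ _ _ (twmul^~ (\1 ⊗ \1)) id) => [|//|a b].
  exact: twmul_linl.
by rewrite twmulE /twmul_tens s1 !amul1r -(linD (tens_linr _)) eoD.
Qed.
Lemma twmulA : associative twmul.
Proof.
move=> x y z.
elim/tens_ind: x => [|x x' h h'|a b].
- by rewrite !(lin0 (twmul_linl _)).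
- by rewrite !twmulDl h h'.
elim/tens_ind: y => [|y y' h h'|c d].
- by rewrite (lin0 (twmul_linr _)) !(lin0 (twmul_linl _)) (lin0 (twmul_linr _)).
- by rewrite !(twmulDl, twmulDr) h h'.
elim/tens_ind: z => [|z z' h h'|f g].
- by rewrite !(lin0 (twmul_linr _)).
- by rewrite !twmulDr h h'.
rewrite !twmulE /twmul_tens !(twmulDl, twmulDr) !twmulE /twmul_tens.
rewrite !sM !sK !eM !oM.
case: (eoK b) => -> -> -> ->; rewrite !amul0l !addr0 !add0r.
by rewrite !amulA -!addrA; congr (_ + _); rewrite addrC -addrA.
Qed.
End TwistedTensor.

Section TensorAlgebra.
Variables (K : fieldType) (A B : ualgType K).

Definition tmul : tensor A B -> tensor A B -> tensor A B :=
  twmul id id (fun _ => 0).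

Let idL (V : lmodType K) : linear (@id V). Proof. by []. Qed.
Let zL : linear (fun _ : B => 0 : B).
Proof. by move=> k x y; rewrite scaler0 addr0. Qed.

Lemma tmulA : associative tmul.
Proof.
by apply: twmulA => // *; rewrite ?(amul0l, amul0r) ?addr0.
Qed.
Lemma tmul1l : left_id (\1 ⊗ \1) tmul.
Proof. exact: twmul1l. Qed.
Lemma tmul1r : right_id (\1 ⊗ \1) tmul.
Proof. by apply: twmul1r => // b; rewrite addr0. Qed.
Lemma tmulDl : left_distributive tmul +%R.
Proof. exact: twmulDl. Qed.
Lemma tmulDr : right_distributive tmul +%R.
Proof. exact: twmulDr. Qed.
Lemma tmulZl k x y : tmul (k *: x) y = k *: tmul x y.
Proof. exact: twmulZl. Qed.
Lemma tmulZr k x y : tmul x (k *: y) = k *: tmul x y.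
Proof. exact: twmulZr. Qed.
HB.instance Definition _ := isUAlg.Build K (tensor A B)
  tmulA tmul1l tmul1r tmulDl tmulDr tmulZl tmulZr.

Lemma tmulE (a c : A) (b d : B) : (a ⊗ b) ** (c ⊗ d) = (a ** c) ⊗ (b ** d).
Proof.
rewrite [LHS](twmulE (s := id) (e := id) (o := fun _ => 0)) //.
by rewrite /twmul_tens amul0l (lin0 (tens_linr _)) addr0.
Qed.
End TensorAlgebra.

(* The grading is presented by its projections gpr n, with finitely many nonzero
   components for each element; the component of degree n is [gpr n x = x]. *)
Record dga (K : fieldType) := DGA {
  dga_alg :> ualgType K;
  gpr : nat -> dga_alg -> dga_alg;
  gdiff : dga_alg -> dga_alg;
  gpr_lin : forall n, linear (gpr n);
  gpr_gpr : forall m n x, gpr m (gpr n x) = if m == n then gpr n x else 0;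
  gpr_sum : forall x, exists N : nat, x = \sum_(n < N) gpr n x;
  gpr_one : gpr 0 \1 = \1;
  gpr_mul : forall m n x y,
    gpr m x = x -> gpr n y = y -> gpr (m + n) (x ** y) = x ** y;
  gdiff_lin : linear gdiff;
  gdiff_deg : forall n x, gpr n x = x -> gpr n.+1 (gdiff x) = gdiff x;
  gdiff_mul : forall n x y, gpr n x = x ->
    gdiff (x ** y) = gdiff x ** y + (-1) ^+ n *: (x ** gdiff y);
  gdiff_gdiff : forall x, gdiff (gdiff x) = 0 }.
Arguments gpr {K d}.
Arguments gdiff {K d}.

Definition hdeg (K : fieldType) (G : dga K) (n : nat) (x : G) : Prop := gpr n x = x.

Record dgahom (K : fieldType) (G G' : dga K) := DGAHom {
  dgahom_alg :> alghom G G';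
  dgahom_pr : forall n x, dgahom_alg (gpr n x) = gpr n (dgahom_alg x);
  dgahom_d : forall x, dgahom_alg (gdiff x) = gdiff (dgahom_alg x) }.

Section GradedTheory.
Variables (K : fieldType) (G : dga K).
Implicit Types x y : G.

Lemma hdeg_gpr n x : hdeg n (gpr n x).
Proof. by rewrite /hdeg gpr_gpr eqxx. Qed.
Lemma hdegE n m x : hdeg n x -> gpr m x = if m == n then x else 0.
Proof. by move=> xn; rewrite -xn gpr_gpr. Qed.
Lemma hdeg0 n : hdeg n (0 : G).
Proof. exact: lin0 (gpr_lin n). Qed.
Lemma hdeg_ind (P : G -> Prop) :
  P 0 -> (forall x y, P x -> P y -> P (x + y)) ->
  (forall n x, hdeg n x -> P x) -> forall x, P x.
Proof.
move=> P0 PD Ph x; case: (gpr_sum x) => N ->.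
by elim/big_ind: _ => // i _; apply/Ph/hdeg_gpr.
Qed.
Lemma hdeg_eq_lin (U : lmodType K) (f g : G -> U) : linear f -> linear g ->
  (forall n x, hdeg n x -> f x = g x) -> f =1 g.
Proof.
move=> fL gL h; elim/hdeg_ind => [|x y hx hy|n x]; last exact: h.
  by rewrite (lin0 fL) (lin0 gL).
by rewrite (linD fL) (linD gL) hx hy.
Qed.

Lemma gbound_subproof x : exists N : nat, x = \sum_(n < N) gpr n x.
Proof. exact: gpr_sum. Qed.
Definition gbound x : nat := sval (cid (gbound_subproof x)).
Lemma gboundP x : x = \sum_(n < gbound x) gpr n x.
Proof. by rewrite /gbound; case: (cid _). Qed.
Lemma gbound_gt x n : (gbound x <= n)%N -> gpr n x = 0.
Proof.
move=> le; rewrite [X in gpr _ X]gboundP (lin_sum (gpr_lin n)) big1 // => i _.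
rewrite gpr_gpr; case: eqP => // eni.
by move: (ltn_ord i); rewrite -eni ltnNge le.
Qed.
Lemma gsumE x N : (gbound x <= N)%N -> x = \sum_(n < N) gpr n x.
Proof.
move=> le; rewrite {1}[x]gboundP (big_ord_widen N (fun n => gpr n x) le).
rewrite big_mkcond; apply: eq_bigr => i _; case: ltnP => // h.
by rewrite gbound_gt.
Qed.

(* Multiplication by c n in degree n. *)
Definition wsum (c : nat -> K) x : G := \sum_(n < gbound x) c n *: gpr n x.

Lemma wsum_widen c x N : (gbound x <= N)%N -> wsum c x = \sum_(n < N) c n *: gpr n x.
Proof.
move=> le; rewrite /wsum (big_ord_widen N (fun n => c n *: gpr n x) le).
rewrite big_mkcond; apply: eq_bigr => i _; case: ltnP => // h.
by rewrite gbound_gt // scaler0.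
Qed.
Lemma wsum_lin c : linear (wsum c).
Proof.
move=> k x y; set N := maxn (gbound x) (maxn (gbound y) (gbound (k *: x + y))).
rewrite !(@wsum_widen _ _ N) ?leq_max ?leqnn ?orbT //.
rewrite scaler_sumr -big_split; apply: eq_bigr => i _ /=.
by rewrite (gpr_lin i) scalerDr !scalerA mulrC.
Qed.
Lemma wsumE c n x : hdeg n x -> wsum c x = c n *: x.
Proof.
move=> xn; rewrite (@wsum_widen _ _ (maxn (gbound x) n.+1)) ?leq_maxl //.
have lt : (n < maxn (gbound x) n.+1)%N by rewrite leq_max ltnSn orbT.
rewrite (bigD1 (Ordinal lt)) //= xn big1 ?addr0 // => i.
by rewrite (hdegE _ xn) -val_eqE /= => /negbTE ->; rewrite scaler0.
Qed.

Definition gsgn : G -> G := wsum (fun n => (-1) ^+ n).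
Definition geven : G -> G := wsum (fun n => (~~ odd n)%:R).
Definition godd : G -> G := wsum (fun n => (odd n)%:R).

Lemma gsgnE n x : hdeg n x -> gsgn x = (-1) ^+ n *: x.
Proof. exact: wsumE. Qed.
Lemma gevenE n x : hdeg n x -> geven x = (~~ odd n)%:R *: x.
Proof. exact: wsumE. Qed.
Lemma goddE n x : hdeg n x -> godd x = (odd n)%:R *: x.
Proof. exact: wsumE. Qed.
Lemma gsgn_lin : linear gsgn. Proof. exact: wsum_lin. Qed.
Lemma geven_lin : linear geven. Proof. exact: wsum_lin. Qed.
Lemma godd_lin : linear godd. Proof. exact: wsum_lin. Qed.

Lemma hdeg_one : hdeg 0 (\1 : G). Proof. exact: gpr_one. Qed.
Lemma hdegM m n x y : hdeg m x -> hdeg n y -> hdeg (m + n) (x ** y).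
Proof. exact: gpr_mul. Qed.
Lemma hdegZ n k x : hdeg n x -> hdeg n (k *: x).
Proof. by move=> xn; rewrite /hdeg (linZ (gpr_lin n)) xn. Qed.
Lemma hdegD n x y : hdeg n x -> hdeg n y -> hdeg n (x + y).
Proof. by move=> xn yn; rewrite /hdeg (linD (gpr_lin n)) xn yn. Qed.

Lemma gsgn1 : gsgn \1 = \1.
Proof. by rewrite (gsgnE hdeg_one) scale1r. Qed.
Lemma geven1 : geven \1 = \1.
Proof. by rewrite (gevenE hdeg_one) scale1r. Qed.
Lemma godd1 : godd \1 = 0.
Proof. by rewrite (goddE hdeg_one) scale0r. Qed.
Lemma gsgnK : involutive gsgn.
Proof.
apply: hdeg_eq_lin => [k x y|//|n x xn]; first by rewrite !gsgn_lin.
by rewrite (gsgnE xn) (linZ gsgn_lin) (gsgnE xn) scalerA -expr2 sqrr_sign scale1r.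
Qed.
Lemma geven_godd x : geven x + godd x = x.
Proof.
elim/hdeg_ind: x => [|x y hx hy|n x xn].
- by rewrite (lin0 geven_lin) (lin0 godd_lin) addr0.
- by rewrite (linD geven_lin) (linD godd_lin) addrACA hx hy.
- by rewrite (gevenE xn) (goddE xn) -scalerDl; case: odd;
    rewrite ?add0r ?addr0 scale1r.
Qed.
Lemma gsgnM : {morph gsgn : x y / x ** y}.
Proof.
move=> x y; elim/hdeg_ind: x => [|x x' h h'|m x xm].
- by rewrite amul0l (lin0 gsgn_lin) amul0l.
- by rewrite amulDl !(linD gsgn_lin) amulDl h h'.
elim/hdeg_ind: y => [|y y' h h'|n y yn].
- by rewrite amul0r (lin0 gsgn_lin) amul0r.
- by rewrite amulDr !(linD gsgn_lin) amulDr h h'.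
rewrite (gsgnE xm) (gsgnE yn) (gsgnE (hdegM xm yn)) amulZl amulZr scalerA.
by rewrite exprD.
Qed.
Lemma gevenM x y : geven (x ** y) = geven x ** geven y + godd x ** godd y.
Proof.
elim/hdeg_ind: x => [|x x' h h'|m x xm].
- by rewrite !(amul0l, lin0 geven_lin, lin0 godd_lin) addr0.
- by rewrite !(amulDl, linD geven_lin, linD godd_lin) h h' addrACA.
elim/hdeg_ind: y => [|y y' h h'|n y yn].
- by rewrite !(amul0r, lin0 geven_lin, lin0 godd_lin) addr0.
- by rewrite !(amulDr, linD geven_lin, linD godd_lin) h h' addrACA.
rewrite (gevenE (hdegM xm yn)) !(gevenE xm, gevenE yn, goddE xm, goddE yn).
rewrite !(amulZl, amulZr) !scalerA -scalerDl oddD.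
by case: (odd m) (odd n) => [] []; rewrite /= ?(mulr0, mulr1, addr0, add0r).
Qed.
Lemma goddM x y : godd (x ** y) = geven x ** godd y + godd x ** geven y.
Proof.
elim/hdeg_ind: x => [|x x' h h'|m x xm].
- by rewrite !(amul0l, lin0 geven_lin, lin0 godd_lin) addr0.
- by rewrite !(amulDl, linD geven_lin, linD godd_lin) h h' addrACA.
elim/hdeg_ind: y => [|y y' h h'|n y yn].
- by rewrite !(amul0r, lin0 geven_lin, lin0 godd_lin) addr0.
- by rewrite !(amulDr, linD geven_lin, linD godd_lin) h h' addrACA.
rewrite (goddE (hdegM xm yn)) !(gevenE xm, gevenE yn, goddE xm, goddE yn).
rewrite !(amulZl, amulZr) !scalerA -scalerDl oddD.
by case: (odd m) (odd n) => [] []; rewrite /= ?(mulr0, mulr1, addr0, add0r).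
Qed.
Lemma geven_goddK x : [/\ geven (geven x) = geven x, godd (geven x) = 0,
  godd (godd x) = godd x & geven (godd x) = 0].
Proof.
elim/hdeg_ind: x => [|x y [h1 h2 h3 h4] [k1 k2 k3 k4]|n x xn].
- by rewrite !(lin0 geven_lin, lin0 godd_lin).
- by rewrite !(linD geven_lin, linD godd_lin) h1 h2 h3 h4 k1 k2 k3 k4 addr0.
rewrite !(gevenE xn, goddE xn, linZ geven_lin, linZ godd_lin) !scalerA.
by case: odd; rewrite !(mulr0, mul0r, mulr1, scale0r).
Qed.
Lemma gdiff1 : gdiff (\1 : G) = 0.
Proof.
have := gdiff_mul \1 hdeg_one; rewrite expr0 scale1r !amul1l amul1r => h.
by apply: (addrI (gdiff \1)); rewrite addr0 -h.
Qed.
End GradedTheory.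

Section GradedTensor.
Variables (K : fieldType) (G1 G2 : dga K).

Definition gtensor : Type := tensor G1 G2.
HB.instance Definition _ := GRing.Lmodule.on gtensor.

Definition gtmul : gtensor -> gtensor -> gtensor :=
  twmul (@gsgn K G1) (@geven K G2) (@godd K G2).

Lemma gtmulA : associative gtmul.
Proof.
apply: twmulA.
- exact: gsgn_lin.
- exact: geven_lin.
- exact: godd_lin.
- exact: gsgnM.
- exact: gsgnK.
- exact: gevenM.
- exact: goddM.
- exact: geven_goddK.
Qed.
Let sL := @gsgn_lin K G1.
Let eL := @geven_lin K G2.
Let oL := @godd_lin K G2.
Lemma gtmul1l : left_id (\1 ⊗ \1 : gtensor) gtmul.
Proof. by apply: twmul1l => //; [apply: geven1 | apply: godd1]. Qed.
Lemma gtmul1r : right_id (\1 ⊗ \1 : gtensor) gtmul.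
Proof. by apply: twmul1r => //; [apply: gsgn1 | apply: geven_godd]. Qed.
Lemma gtmulDl : left_distributive gtmul +%R.
Proof. exact: twmulDl. Qed.
Lemma gtmulDr : right_distributive gtmul +%R.
Proof. exact: twmulDr. Qed.
Lemma gtmulZl k x y : gtmul (k *: x) y = k *: gtmul x y.
Proof. exact: twmulZl. Qed.
Lemma gtmulZr k x y : gtmul x (k *: y) = k *: gtmul x y.
Proof. exact: twmulZr. Qed.
HB.instance Definition _ := isUAlg.Build K gtensor
  gtmulA gtmul1l gtmul1r gtmulDl gtmulDr gtmulZl gtmulZr.

Definition gtens (a : G1) (b : G2) : gtensor := a ⊗ b.

Lemma gtmulE m n (a c : G1) (b d : G2) : hdeg m b -> hdeg n c ->
  gtens a b ** gtens c d = (-1) ^+ (m * n) *: gtens (a ** c) (b ** d).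
Proof.
move=> bm cn; rewrite [LHS]twmulE // /twmul_tens (gevenE bm) (goddE bm) (gsgnE cn).
rewrite !(amulZl, amulZr).
rewrite !(linZ (tens_linl _)) !(linZ (tens_linr _)).
rewrite exprM -[(-1) ^+ m]signr_odd; case: (odd m).
  by rewrite scale0r add0r scalerA mulr1 expr1.
by rewrite expr0 expr1n scale0r scaler0 addr0.
Qed.

Definition gt_pr (n : nat) (x : gtensor) : gtensor :=
  \sum_(k < n.+1) tmap (gpr k) (gpr (n - k)) x.
Definition gt_diff (x : gtensor) : gtensor :=
  tmap gdiff id x + tmap (@gsgn K G1) gdiff x.

Let idL (V : lmodType K) : linear (@id V). Proof. by []. Qed.

Lemma gt_pr_lin n : linear (gt_pr n).
Proof.
move=> k x y; rewrite /gt_pr scaler_sumr -big_split; apply: eq_bigr => i _ /=.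
exact: tmap_lin (gpr_lin _) (gpr_lin _) _ _ _.
Qed.
Lemma gt_diff_lin : linear gt_diff.
Proof.
move=> k x y; rewrite /gt_diff.
rewrite (tmap_lin (@gdiff_lin _ _) (@idL _)) (tmap_lin (@gsgn_lin _ _) (@gdiff_lin _ _)).
by rewrite scalerDr addrACA.
Qed.
Lemma gt_prE n p q (a : G1) (b : G2) : hdeg p a -> hdeg q b ->
  gt_pr n (gtens a b) = if n == (p + q)%N then gtens a b else 0.
Proof.
move=> ap bq; rewrite /gt_pr /gtens.
have E (k : 'I_n.+1) : tmap (gpr k) (gpr (n - k)) (a ⊗ b) =
    if (k == p :> nat) && (n - k == q)%N then a ⊗ b else 0.
  rewrite tmapE; try exact: gpr_lin.
  rewrite (hdegE _ ap) (hdegE _ bq); case: eqP => _ /=; last first.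
    by rewrite (lin0 (tens_linl _)).
  by case: eqP => // _; rewrite (lin0 (tens_linr _)).
rewrite (eq_bigr _ (fun k _ => E k)); case: eqP => [enpq|npq].
  have lt : (p < n.+1)%N by rewrite enpq ltnS leq_addr.
  have enq : (n - p)%N = q by rewrite enpq addKn.
  rewrite (bigD1 (Ordinal lt)) //= eqxx enq eqxx /= big1 ?addr0 // => i.
  by rewrite -val_eqE /= => /negbTE ->.
rewrite big1 // => k _; case: eqP => //= ekp; case: eqP => // enq.
by case: npq; rewrite -ekp -enq subnKC // -ltnS.
Qed.
Lemma gt_diffE p (a : G1) (b : G2) : hdeg p a ->
  gt_diff (gtens a b) = gtens (gdiff a) b + (-1) ^+ p *: gtens a (gdiff b).
Proof.
move=> ap; rewrite /gt_diff /gtens !tmapE //; try exact: gdiff_lin; try exact: gsgn_lin.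
by rewrite (gsgnE ap) (linZ (tens_linl _)).
Qed.

Lemma gt_ind (P : gtensor -> Prop) :
  P 0 -> (forall x y, P x -> P y -> P (x + y)) ->
  (forall p q a b, hdeg p a -> hdeg q b -> P (gtens a b)) -> forall x, P x.
Proof.
move=> P0 PD Ph; elim/tens_ind => // a b.
elim/hdeg_ind: a => [|a a' h h'|p a ap].
- by rewrite (lin0 (tens_linl _)).
- by rewrite (linD (tens_linl _)); apply: PD.
elim/hdeg_ind: b => [|b b' h h'|q b bq].
- by rewrite (lin0 (tens_linr _)).
- by rewrite (linD (tens_linr _)); apply: PD.
exact: Ph ap bq.
Qed.

Lemma gt_pr_gpr m n x : gt_pr m (gt_pr n x) = if m == n then gt_pr n x else 0.
Proof.
elim/gt_ind: x => [|x y h h'|p q a b ap bq].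
- by rewrite !(lin0 (gt_pr_lin _)) if_same.
- by rewrite !(linD (gt_pr_lin _)) h h'; case: eqP; rewrite ?addr0.
rewrite (gt_prE n ap bq); case: (altP (n =P _)) => [->|ne].
  exact: gt_prE.
by rewrite (lin0 (gt_pr_lin _)) if_same.
Qed.
Lemma gt_pr_bound x : exists N, forall M, (N <= M)%N -> x = \sum_(n < M) gt_pr n x.
Proof.
elim/gt_ind: x => [|x y [N h] [N' h']|p q a b ap bq].
- by exists 0 => M _; rewrite big1 // => i _; apply: lin0 (gt_pr_lin _).
- exists (maxn N N') => M; rewrite geq_max => /andP[le le'].
  rewrite {1}(h M le) {1}(h' M le') -big_split; apply: eq_bigr => i _ /=.
  by rewrite (linD (gt_pr_lin _)).
exists (p + q).+1 => M lt; rewrite (bigD1 (Ordinal lt)) //= (gt_prE _ ap bq) eqxx.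
rewrite big1 ?addr0 // => i; rewrite -val_eqE (gt_prE _ ap bq) /=.
by move=> /negbTE ->.
Qed.
Lemma gt_pr_sum x : exists N, x = \sum_(n < N) gt_pr n x.
Proof. by case: (gt_pr_bound x) => N h; exists N; apply: h. Qed.
Lemma gt_pr_one : gt_pr 0 (\1 : gtensor) = \1.
Proof. by rewrite [LHS](gt_prE 0 (hdeg_one G1) (hdeg_one G2)). Qed.
Lemma gt_pr_mul m n (x y : gtensor) : gt_pr m x = x -> gt_pr n y = y ->
  gt_pr (m + n) (x ** y) = x ** y.
Proof.
move=> <- <-.
elim/gt_ind: x => [|x x' h h'|p q a b ap bq].
- by rewrite !(lin0 (gt_pr_lin _), amul0l).
- by rewrite !(linD (gt_pr_lin _), amulDl) h h'.
rewrite (gt_prE m ap bq); case: eqP => [->|_]; last first.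
  by rewrite amul0l (lin0 (gt_pr_lin _)).
elim/gt_ind: y => [|y y' h h'|r s c d cr ds].
- by rewrite !(lin0 (gt_pr_lin _), amul0r).
- by rewrite !(linD (gt_pr_lin _), amulDr) h h'.
rewrite (gt_prE n cr ds); case: eqP => [->|_]; last first.
  by rewrite amul0r (lin0 (gt_pr_lin _)).
rewrite (gtmulE a d bq cr) (linZ (gt_pr_lin _)).
by rewrite (gt_prE _ (hdegM ap cr) (hdegM bq ds)) addnACA eqxx.
Qed.
Lemma gt_diff_deg n x : gt_pr n x = x -> gt_pr n.+1 (gt_diff x) = gt_diff x.
Proof.
move=> <-; elim/gt_ind: x => [|x y h h'|p q a b ap bq].
- by rewrite !(lin0 (gt_pr_lin _), lin0 gt_diff_lin).
- by rewrite (linD (gt_pr_lin n)) !(linD gt_diff_lin) (linD (gt_pr_lin n.+1)) h h'.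
rewrite (gt_prE n ap bq); case: eqP => [->|_]; last first.
  by rewrite !(lin0 (gt_pr_lin _), lin0 gt_diff_lin).
rewrite (gt_diffE b ap) (linD (gt_pr_lin _)) (linZ (gt_pr_lin _)).
rewrite (gt_prE _ (gdiff_deg ap) bq) (gt_prE _ ap (gdiff_deg bq)).
by rewrite addSn addnS eqxx.
Qed.
Lemma gt_diff_mul n (x y : gtensor) : gt_pr n x = x ->
  gt_diff (x ** y) = gt_diff x ** y + (-1) ^+ n *: (x ** gt_diff y).
Proof.
have sgnE (i j : nat) : odd i = odd j -> (-1) ^+ i = (-1) ^+ j :> K.
  by move=> ij; rewrite -signr_odd ij signr_odd.
move=> <-; elim/gt_ind: x => [|x x' h h'|p q a b ap bq].
- by rewrite (lin0 (gt_pr_lin _)) amul0l (lin0 gt_diff_lin) !amul0l scaler0 addr0.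
- rewrite (linD (gt_pr_lin n)) amulDl !(linD gt_diff_lin) h h' !amulDl scalerDr.
  by rewrite addrACA.
rewrite (gt_prE n ap bq); case: eqP => [->|_]; last first.
  by rewrite amul0l (lin0 gt_diff_lin) !amul0l scaler0 addr0.
elim/gt_ind: y => [|y y' h h'|r s c d cr ds].
- by rewrite amul0r (lin0 gt_diff_lin) !amul0r scaler0 add0r.
- rewrite (amulDr (gtens a b : gtensor)) !(linD gt_diff_lin) h h'.
  rewrite (amulDr (gtens a b : gtensor) (gt_diff y)) (amulDr (gt_diff (gtens a b)) y).
  by rewrite scalerDr addrACA.
rewrite (gtmulE a d bq cr) (linZ gt_diff_lin) (gt_diffE _ (hdegM ap cr)).
rewrite (gdiff_mul c ap) (gdiff_mul d bq) (gt_diffE b ap) (gt_diffE d cr).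
rewrite !(amulDl, amulDr) !(amulZl, amulZr).
rewrite (gtmulE (gdiff a) d bq cr) (gtmulE a d (gdiff_deg bq) cr).
rewrite (gtmulE a d bq (gdiff_deg cr)) (gtmulE a (gdiff d) bq cr).
rewrite /gtens !(linD (tens_linl _), linD (tens_linr _)).
rewrite !(linZ (tens_linl _), linZ (tens_linr _)) !scalerDr !scalerA.
rewrite -!exprD -!addrA; congr (_ + _).
rewrite [RHS]addrCA; congr (_ + (_ + _)).
- congr (_ *: _); apply: sgnE; rewrite !(oddD, oddM, oddS) /=.
  by case: (odd p); case: (odd q); case: (odd r).
- congr (_ *: _); apply: sgnE; rewrite !(oddD, oddM, oddS) /=.
  by case: (odd p); case: (odd q); case: (odd r).
- congr (_ *: _); apply: sgnE; rewrite !(oddD, oddM, oddS) /=.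
  by case: (odd p); case: (odd q); case: (odd r).
Qed.
Lemma gt_diff_diff (x : gtensor) : gt_diff (gt_diff x) = 0.
Proof.
elim/gt_ind: x => [|x y h h'|p q a b ap bq].
- by rewrite !(lin0 gt_diff_lin).
- rewrite [gt_diff (x + y)](linD gt_diff_lin) [LHS](linD gt_diff_lin) h h'.
  exact: addr0.
rewrite (gt_diffE b ap) (linD gt_diff_lin) (linZ gt_diff_lin).
rewrite (gt_diffE _ (gdiff_deg ap)) (gt_diffE _ ap) !gdiff_gdiff.
rewrite /gtens (lin0 (tens_linl _)) (lin0 (tens_linr _)) scaler0 addr0 add0r.
by rewrite -scalerDl exprS mulN1r addNr scale0r.
Qed.

Definition gtensor_dga : dga K := DGA gt_pr_lin gt_pr_gpr gt_pr_sum gt_pr_one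
  gt_pr_mul gt_diff_lin gt_diff_deg gt_diff_mul gt_diff_diff.
End GradedTensor.

Record dgideal (K : fieldType) (G : dga K) := DGIdeal {
  dgideal_ideal :> ideal G;
  dgideal_pr : forall n x, dgideal_ideal x -> dgideal_ideal (gpr n x);
  dgideal_d : forall x, dgideal_ideal x -> dgideal_ideal (gdiff x) }.

Section DGIdeals.
Variables (K : fieldType) (G : dga K).

Lemma ker_pr_subproof (G' : dga K) (f : dgahom G G') n x :
  ker_ideal f x -> ker_ideal f (gpr n x).
Proof.
by rewrite /= /ker_set dgahom_pr => ->; apply: lin0 (gpr_lin n).
Qed.
Lemma ker_d_subproof (G' : dga K) (f : dgahom G G') x :
  ker_ideal f x -> ker_ideal f (gdiff x).
Proof.
by rewrite /= /ker_set dgahom_d => ->; apply: lin0 (@gdiff_lin _ _).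
Qed.
Definition ker_dgideal (G' : dga K) (f : dgahom G G') : dgideal G :=
  DGIdeal (@ker_pr_subproof G' f) (@ker_d_subproof G' f).

Definition cap_dgideal (I : Type) (J : I -> dgideal G) : dgideal G :=
  @DGIdeal K G (cap_ideal J)
    (fun n x Jx i => dgideal_pr n (Jx i)) (fun x Jx i => dgideal_d (Jx i)).

Lemma sum_pr_subproof (J J' : dgideal G) n x :
  sum_ideal J J' x -> sum_ideal J J' (gpr n x).
Proof.
move=> [u [v [Ju Jv ->]]]; exists (gpr n u), (gpr n v).
by rewrite (linD (gpr_lin n)); split=> //; apply: dgideal_pr.
Qed.
Lemma sum_d_subproof (J J' : dgideal G) x :
  sum_ideal J J' x -> sum_ideal J J' (gdiff x).
Proof.
move=> [u [v [Ju Jv ->]]]; exists (gdiff u), (gdiff v).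
by rewrite (linD (@gdiff_lin _ _)); split=> //; apply: dgideal_d.
Qed.
Definition sum_dgideal (J J' : dgideal G) : dgideal G :=
  DGIdeal (@sum_pr_subproof J J') (@sum_d_subproof J J').

Section Quotient.
Variable J : dgideal G.
Local Notation Q := (quotient J).

Definition q_pr (n : nat) (x : Q) : Q := qproj J (gpr n (repr x)).
Definition q_d (x : Q) : Q := qproj J (gdiff (repr x)).

Let pL := qproj_lin J.

Lemma q_prE n a : q_pr n (qproj J a) = qproj J (gpr n a).
Proof.
apply/qprojP; rewrite -(linB (gpr_lin n)).
by apply: dgideal_pr; apply: repr_qproj.
Qed.
Lemma q_dE a : q_d (qproj J a) = qproj J (gdiff a).
Proof.
apply/qprojP; rewrite -(linB (@gdiff_lin _ _)).
by apply: dgideal_d; apply: repr_qproj.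
Qed.
Lemma q_pr_lin n : linear (q_pr n).
Proof.
move=> k x y; case: (quotP x) (quotP y) => a -> [b ->].
by rewrite -pL !q_prE (gpr_lin n) pL.
Qed.
Lemma q_d_lin : linear q_d.
Proof.
move=> k x y; case: (quotP x) (quotP y) => a -> [b ->].
by rewrite -pL !q_dE gdiff_lin pL.
Qed.
Lemma q_pr_pr m n x : q_pr m (q_pr n x) = if m == n then q_pr n x else 0.
Proof.
case: (quotP x) => a ->; rewrite !q_prE gpr_gpr.
by case: eqP => // _; apply: lin0 pL.
Qed.
Lemma q_pr_sum x : exists N, x = \sum_(n < N) q_pr n x.
Proof.
case: (quotP x) => a ->; case: (gpr_sum a) => N h; exists N.
by rewrite {1}h (lin_sum pL); apply: eq_bigr => i _; rewrite q_prE.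
Qed.
Lemma q_pr_one : q_pr 0 \1 = \1.
Proof. by rewrite [LHS]q_prE gpr_one. Qed.
Lemma q_hdeg n x : q_pr n x = x -> exists2 a, hdeg n a & x = qproj J a.
Proof.
case: (quotP x) => a ->; rewrite q_prE => <-.
by exists (gpr n a) => //; apply: hdeg_gpr.
Qed.
Lemma q_pr_mul m n (x y : Q) : q_pr m x = x -> q_pr n y = y ->
  q_pr (m + n) (x ** y) = x ** y.
Proof.
move=> /q_hdeg[a am ->] /q_hdeg[b bn ->].
by rewrite -qproj_mul q_prE (gpr_mul am bn).
Qed.
Lemma q_d_deg n x : q_pr n x = x -> q_pr n.+1 (q_d x) = q_d x.
Proof. by move=> /q_hdeg[a an ->]; rewrite q_dE q_prE (gdiff_deg an). Qed.
Lemma q_d_mul n (x y : Q) : q_pr n x = x ->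
  q_d (x ** y) = q_d x ** y + (-1) ^+ n *: (x ** q_d y).
Proof.
move=> /q_hdeg[a an ->]; case: (quotP y) => b ->.
rewrite -qproj_mul !q_dE (gdiff_mul _ an).
by rewrite (linD pL) (linZ pL) !qproj_mul.
Qed.
Lemma q_d_d x : q_d (q_d x) = 0.
Proof. by case: (quotP x) => a ->; rewrite !q_dE gdiff_gdiff; apply: lin0 pL. Qed.

Definition quotient_dga : dga K := DGA q_pr_lin q_pr_pr q_pr_sum q_pr_one
  q_pr_mul q_d_lin q_d_deg q_d_mul q_d_d.

(* The homomorphism induced on G/J by one that kills J. *)
Section Lift.
Variables (G' : dga K) (f : dgahom G G') (fJ : forall x, J x -> f x = 0).

Definition qlift (x : quotient_dga) : G' := f (repr (x : Q)).
Lemma qliftE a : qlift (qproj J a) = f a.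
Proof.
apply/eqP; rewrite -subr_eq0 -(linB (alghom_lin f)); apply/eqP/fJ.
exact: repr_qproj.
Qed.
Lemma qlift_lin : linear qlift.
Proof.
move=> k x y; case: (quotP x) (quotP y) => a -> [b ->].
by rewrite -pL !qliftE (alghom_lin f).
Qed.
Lemma qlift_mul : {morph qlift : x y / x ** y}.
Proof.
move=> x y; case: (quotP x) (quotP y) => a -> [b ->].
by rewrite -[qproj J a ** _](qproj_mul J) !qliftE alghom_mul.
Qed.
Lemma qlift_one : qlift \1 = \1.
Proof. by rewrite [LHS]qliftE alghom_one. Qed.
Definition qlift_alghom : alghom quotient_dga G' := AlgHom qlift_lin qlift_mul qlift_one.
Lemma qlift_pr n x : qlift_alghom (gpr n x) = gpr n (qlift_alghom x).
Proof.
by case: (quotP x) => a ->; rewrite /= q_prE !qliftE dgahom_pr.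
Qed.
Lemma qlift_d x : qlift_alghom (gdiff x) = gdiff (qlift_alghom x).
Proof. by case: (quotP x) => a ->; rewrite /= q_dE !qliftE dgahom_d. Qed.
Definition qlift_hom : dgahom quotient_dga G' := DGAHom qlift_pr qlift_d.
End Lift.
End Quotient.
End DGIdeals.

(* Sub-DGAs S of the product of finitely many DGAs G_i. *)
Record subproduct (K : fieldType) (I : finType) (G : I -> dga K) := SubProduct {
  sp_set :> (forall i, G i) -> Prop;
  sp_lin : forall k x y, sp_set x -> sp_set y -> sp_set (fun i => k *: x i + y i);
  sp_one : sp_set (fun i => \1);
  sp_mul : forall x y, sp_set x -> sp_set y -> sp_set (fun i => x i ** y i);
  sp_pr : forall n x, sp_set x -> sp_set (fun i => gpr n (x i));
  sp_d : forall x, sp_set x -> sp_set (fun i => gdiff (x i)) }.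

Section SubProduct.
Variables (K : fieldType) (I : finType) (G : I -> dga K) (S : subproduct G).

Record subprod : Type := SubProd { spfam :> forall i, G i; spfamP : S spfam }.
HB.instance Definition _ := gen_eqMixin subprod.
HB.instance Definition _ := gen_choiceMixin subprod.

Lemma fam_eq (x y : forall i, G i) : (forall i, x i = y i) -> x = y.
Proof. exact: functional_extensionality_dep. Qed.
Lemma subprod_eq (x y : subprod) : (forall i, x i = y i) -> x = y.
Proof.
case: x y => x Sx [y Sy] /= h; move: Sx Sy; rewrite (fam_eq h) => Sx Sy.
by congr SubProd; apply: Prop_irrelevance.
Qed.

Lemma sp_zero : S (fun i => 0).
Proof.
have := sp_lin (-1) (sp_one S) (sp_one S); congr (sp_set S _); apply: fam_eq => i.
by rewrite scaleN1r addNr.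
Qed.
Lemma sp_scale k x : S x -> S (fun i => k *: x i).
Proof.
move=> Sx; have := sp_lin k Sx sp_zero; congr (sp_set S _); apply: fam_eq => i.
by rewrite addr0.
Qed.
Lemma sp_add x y : S x -> S y -> S (fun i => x i + y i).
Proof.
move=> Sx Sy; have := sp_lin 1 Sx Sy; congr (sp_set S _); apply: fam_eq => i.
by rewrite scale1r.
Qed.
Lemma sp_opp x : S x -> S (fun i => - x i).
Proof.
move=> Sx; have := sp_scale (-1) Sx; congr (sp_set S _); apply: fam_eq => i.
by rewrite scaleN1r.
Qed.

Definition sp0 := SubProd sp_zero.
Definition spadd (x y : subprod) := SubProd (sp_add (spfamP x) (spfamP y)).
Definition spopp (x : subprod) := SubProd (sp_opp (spfamP x)).
Definition spscale k (x : subprod) := SubProd (sp_scale k (spfamP x)).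
Definition sp1 := SubProd (sp_one S).
Definition spmul (x y : subprod) := SubProd (sp_mul (spfamP x) (spfamP y)).
Definition sppr n (x : subprod) := SubProd (sp_pr n (spfamP x)).
Definition spd (x : subprod) := SubProd (sp_d (spfamP x)).

Lemma spaddA : associative spadd.
Proof. by move=> x y z; apply: subprod_eq => i; apply: addrA. Qed.
Lemma spaddC : commutative spadd.
Proof. by move=> x y; apply: subprod_eq => i; apply: addrC. Qed.
Lemma spadd0 : left_id sp0 spadd.
Proof. by move=> x; apply: subprod_eq => i; apply: add0r. Qed.
Lemma spaddN : left_inverse sp0 spopp spadd.
Proof. by move=> x; apply: subprod_eq => i; apply: addNr. Qed.
HB.instance Definition _ := GRing.isZmodule.Build subprod spaddA spaddC spadd0 spaddN.

Lemma spscaleA a b x : spscale a (spscale b x) = spscale (a * b) x.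
Proof. by apply: subprod_eq => i; apply: scalerA. Qed.
Lemma spscale1 : left_id 1 spscale.
Proof. by move=> x; apply: subprod_eq => i; apply: scale1r. Qed.
Lemma spscaleDr : right_distributive spscale +%R.
Proof. by move=> k x y; apply: subprod_eq => i; apply: scalerDr. Qed.
Lemma spscaleDl x : {morph spscale^~ x : a b / a + b}.
Proof. by move=> a b; apply: subprod_eq => i; apply: scalerDl. Qed.
HB.instance Definition _ := GRing.Zmodule_isLmodule.Build K subprod
  spscaleA spscale1 spscaleDr spscaleDl.

Lemma spmulA : associative spmul.
Proof. by move=> x y z; apply: subprod_eq => i; apply: amulA. Qed.
Lemma spmul1l : left_id sp1 spmul.
Proof. by move=> x; apply: subprod_eq => i; apply: amul1l. Qed.
Lemma spmul1r : right_id sp1 spmul.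
Proof. by move=> x; apply: subprod_eq => i; apply: amul1r. Qed.
Lemma spmulDl : left_distributive spmul +%R.
Proof. by move=> x y z; apply: subprod_eq => i; apply: amulDl. Qed.
Lemma spmulDr : right_distributive spmul +%R.
Proof. by move=> x y z; apply: subprod_eq => i; apply: amulDr. Qed.
Lemma spmulZl k x y : spmul (k *: x) y = k *: spmul x y.
Proof. by apply: subprod_eq => i; apply: amulZl. Qed.
Lemma spmulZr k x y : spmul x (k *: y) = k *: spmul x y.
Proof. by apply: subprod_eq => i; apply: amulZr. Qed.
HB.instance Definition _ := isUAlg.Build K subprod
  spmulA spmul1l spmul1r spmulDl spmulDr spmulZl spmulZr.

Lemma spfam_sum (J : Type) (r : seq J) (F : J -> subprod) i :
  (\sum_(j <- r) F j) i = \sum_(j <- r) F j i.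
Proof.
elim: r => [|j r IH]; first by rewrite !big_nil.
by rewrite !big_cons -IH.
Qed.

Lemma sppr_lin n : linear (sppr n).
Proof. by move=> k x y; apply: subprod_eq => i; apply: gpr_lin. Qed.
Lemma sppr_pr m n x : sppr m (sppr n x) = if m == n then sppr n x else 0.
Proof.
by case: eqP => mn; apply: subprod_eq => i; rewrite /= gpr_gpr; case: eqP.
Qed.
Lemma sppr_sum (x : subprod) : exists N, x = \sum_(n < N) sppr n x.
Proof.
exists (\max_i gbound (x i)); apply: subprod_eq => i; rewrite spfam_sum /=.
by apply: gsumE; apply: (leq_bigmax i).
Qed.
Lemma sppr_one : sppr 0 \1 = \1.
Proof. by apply: subprod_eq => i; apply: gpr_one. Qed.
Lemma sp_hdeg n (x : subprod) : sppr n x = x -> forall i, gpr n (x i) = x i.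
Proof. by move=> xn i; rewrite -{2}xn. Qed.
Lemma sppr_mul m n (x y : subprod) : sppr m x = x -> sppr n y = y ->
  sppr (m + n) (x ** y) = x ** y.
Proof.
move=> /sp_hdeg xm /sp_hdeg yn; apply: subprod_eq => i.
exact: gpr_mul.
Qed.
Lemma spd_lin : linear spd.
Proof. by move=> k x y; apply: subprod_eq => i; apply: gdiff_lin. Qed.
Lemma spd_deg n x : sppr n x = x -> sppr n.+1 (spd x) = spd x.
Proof. by move=> /sp_hdeg xn; apply: subprod_eq => i; apply: gdiff_deg. Qed.
Lemma spd_mul n (x y : subprod) : sppr n x = x ->
  spd (x ** y) = spd x ** y + (-1) ^+ n *: (x ** spd y).
Proof. by move=> /sp_hdeg xn; apply: subprod_eq => i; apply: gdiff_mul. Qed.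
Lemma spd_d x : spd (spd x) = 0.
Proof. by apply: subprod_eq => i; apply: gdiff_gdiff. Qed.

Definition subprod_dga : dga K := DGA sppr_lin sppr_pr sppr_sum sppr_one
  sppr_mul spd_lin spd_deg spd_mul spd_d.
End SubProduct.

Section Hopf.
Variable K : fieldType.

Record hopf := Hopf {
  hopf_alg :> ualgType K;
  cop : alghom hopf_alg (tensor hopf_alg hopf_alg);
  counit : hopf_alg -> K;
  antipode : hopf_alg -> hopf_alg;
  cop_coassoc : forall h, tmap cop id (cop h) = tassoc (tmap id cop (cop h));
  counit_lin : scalar counit;
  counit_mul : forall x y, counit (x ** y) = counit x * counit y;
  counit_one : counit \1 = 1;
  counitl : forall h, tlift (fun x y => counit x *: y) (cop h) = h;
  counitr : forall h, tlift (fun x y => counit y *: x) (cop h) = h;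
  antipode_lin : linear antipode;
  antipodel : forall h, tlift (fun x y => antipode x ** y) (cop h) = counit h *: \1;
  antipoder : forall h, tlift (fun x y => x ** antipode y) (cop h) = counit h *: \1 }.

(* id ⊗ rho, reassociated. *)
Definition id_tens (V W U : lmodType K) (rho : W -> tensor W U) (x : tensor V W) :
  tensor (tensor V W) U := tassoc (tmap id rho x).

Definition coaction (H : hopf) (V : lmodType K) (rho : V -> tensor V H) : Prop :=
  [/\ linear rho,
      forall v, tmap rho id (rho v) = id_tens (@cop H) (rho v) &
      forall v, tlift (fun x h => counit h *: x) (rho v) = v].
End Hopf.

Section Coverings.
Variables (K : fieldType) (A : ualgType K).

(* The map A/J -> A/J' induced by the identity, meant for J contained in J'. *)
Definition qmap (J J' : ideal A) (x : quotient J) : quotient J' := qproj J' (repr x).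

Definition covering (I : finType) (J : I -> ideal A) : Prop :=
  forall x, (forall i, J i x) -> x = 0.

Definition complete_covering (I : finType) (J : I -> ideal A) : Prop :=
  covering J /\
  forall b : forall i, quotient (J i),
    (forall i j, qmap (sum_ideal (J i) (J j)) (b i) = qmap (sum_ideal (J i) (J j)) (b j)) ->
    exists x, forall i, qproj (J i) x = b i.
End Coverings.

Record bundle (K : fieldType) := Bundle {
  bI : finType;
  bB : ualgType K;
  bJ : bI -> ideal bB;
  bJ_covering : complete_covering bJ;
  bH : hopf K;
  bP : ualgType K;
  bDelta : alghom bP (tensor bP bH);
  bDelta_coaction : coaction bDelta;
  biota : alghom bB bP;
  biota_inj : injective biota;
  bchi : forall i, alghom bP (tensor (quotient (bJ i)) bH);
  bchi_surj : forall i y, exists f, bchi i f = y;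
  bchi_iota : forall i b, bchi i (biota b) = qproj (bJ i) b ⊗ \1;
  bchi_Delta : forall i f,
    tmap (bchi i) id (bDelta f) = id_tens (@cop K bH) (bchi i f);
  bchi_covering : complete_covering (fun i => ker_ideal (bchi i)) }.

Section DifferentialAlgebras.
Variable K : fieldType.

Definition subalgebra (A : ualgType K) (S : A -> Prop) : Prop :=
  [/\ S \1, forall k x y, S x -> S y -> S (k *: x + y) &
      forall x y, S x -> S y -> S (x ** y)].

Record dalg (A : ualgType K) := DAlg {
  dalg_dga :> dga K;
  dalg_in : alghom A dalg_dga;
  dalg_in_inj : injective dalg_in;
  dalg_deg0 : forall x, hdeg 0 x <-> exists a, x = dalg_in a;
  dalg_gen : forall S : dalg_dga -> Prop, subalgebra S ->
    (forall a, S (dalg_in a)) -> (forall a, S (gdiff (dalg_in a))) -> forall x, S x }.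

Definition universal (A : ualgType K) (Om : dalg A) : Prop :=
  forall (G : dga K) (f : alghom A G), (forall a, hdeg 0 (f a)) ->
    exists F : dgahom Om G, forall a, F (dalg_in Om a) = f a.

Record udalg (A : ualgType K) := UDAlg {
  udalg_dalg :> dalg A;
  udalgP : universal udalg_dalg }.

(* The homomorphism of DGAs extending f; it is unique by dalg_gen. *)
Definition udalg_ext (A : ualgType K) (Om : udalg A) (G : dga K) (f : alghom A G)
    (f0 : forall a, hdeg 0 (f a)) : dgahom Om G :=
  sval (cid (udalgP Om f0)).

Record rcdalg (H : hopf K) := RCDAlg {
  rc_dalg :> dalg H;
  rc_co : alghom rc_dalg (tensor rc_dalg H);
  rc_coaction : coaction rc_co;
  rc_in : forall h, rc_co (dalg_in rc_dalg h) = tmap (dalg_in rc_dalg) id (cop H h);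
  rc_d : forall x, rc_co (gdiff x) = tmap gdiff id (rc_co x) }.

Section TensorIncl.
Variables (A1 A2 : ualgType K) (G1 : dalg A1) (G2 : dalg A2).

Definition gt_in : tensor A1 A2 -> gtensor_dga G1 G2 :=
  tmap (dalg_in G1) (dalg_in G2).

Let L1 := alghom_lin (dalg_in G1).
Let L2 := alghom_lin (dalg_in G2).

Lemma dalg_in_deg0 (A : ualgType K) (G : dalg A) a : hdeg 0 (dalg_in G a).
Proof. by apply/dalg_deg0; exists a. Qed.

Lemma gt_in_lin : linear gt_in.
Proof. exact: tmap_lin. Qed.
Lemma gt_inE a b : gt_in (a ⊗ b) = gtens (dalg_in G1 a) (dalg_in G2 b).
Proof. exact: tmapE. Qed.
Lemma gt_in_mul : {morph gt_in : x y / x ** y}.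
Proof.
move=> x y; elim/tens_ind: x => [|x x' h h'|a b].
- by rewrite amul0l (lin0 gt_in_lin) amul0l.
- by rewrite amulDl !(linD gt_in_lin) amulDl h h'.
elim/tens_ind: y => [|y y' h h'|c d].
- by rewrite amul0r (lin0 gt_in_lin) amul0r.
- rewrite amulDr !(linD gt_in_lin) h h'.
  by rewrite (amulDr (gt_in (a ⊗ b)) (gt_in y)).
rewrite tmulE !gt_inE !alghom_mul.
rewrite [RHS](gtmulE _ _ (dalg_in_deg0 _ _) (dalg_in_deg0 _ _)).
by rewrite expr0 scale1r.
Qed.
Lemma gt_in_one : gt_in \1 = \1.
Proof. by rewrite [LHS]gt_inE !alghom_one. Qed.
Definition gt_in_hom : alghom (tensor A1 A2) (gtensor_dga G1 G2) :=
  AlgHom gt_in_lin gt_in_mul gt_in_one.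
Lemma gt_in_deg0 x : hdeg 0 (gt_in x).
Proof.
elim/tens_ind: x => [|x y h h'|a b].
- by rewrite (lin0 gt_in_lin); apply: hdeg0.
- by rewrite (linD gt_in_lin); apply: hdegD.
by rewrite gt_inE /hdeg [LHS](gt_prE 0 (dalg_in_deg0 _ _) (dalg_in_deg0 _ _)).
Qed.
End TensorIncl.

Lemma comp_alghom_subproof (A B C : ualgType K) (g : alghom B C) (f : alghom A B) :
  [/\ linear (g \o f), {morph g \o f : x y / x ** y} & (g \o f) \1 = \1].
Proof.
split=> [k x y|x y|] /=; first by rewrite !alghom_lin.
- by rewrite !alghom_mul.
- by rewrite !alghom_one.
Qed.
Definition comp_alghom (A B C : ualgType K) (g : alghom B C) (f : alghom A B) :
    alghom A C :=
  let P := comp_alghom_subproof g f in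
  AlgHom (let: And3 h _ _ := P in h) (let: And3 _ h _ := P in h)
         (let: And3 _ _ h := P in h).
End DifferentialAlgebras.

(* Gloc i is Gamma(B_i) ⊗^ Gamma(H), JP i is J_i(P), GP is Gamma(P), KP i is the
   kernel K_i of chi_i on Gamma(P), Gc is Gamma_c(P), Gm is Gamma_m(B); chiOm i,
   chiG i and chic i are the maps induced by chi_i on Omega(P), Gamma(P) and
   Gamma_c(P), and chi0 i is chi_i followed by the inclusion of the degree-0 part. *)
Section DifferentialStructure.
Variables (K : fieldType) (E : bundle K).

Record dstruct := DStruct {
  dsB : forall i : bI E, dalg (quotient (@bJ K E i));
  dsH : rcdalg (bH E);
  dsOm : udalg (bP E) }.

Variable D : dstruct.

Definition Gloc (i : bI E) : dga K := gtensor_dga (dsB D i) (dsH D).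
Definition chi0 (i : bI E) : alghom (bP E) (Gloc i) :=
  comp_alghom (gt_in_hom (dsB D i) (dsH D)) (@bchi K E i).
Lemma chi0_deg0 i f : hdeg 0 (chi0 i f).
Proof. exact: gt_in_deg0. Qed.

Definition chiOm (i : bI E) : dgahom (dsOm D) (Gloc i) :=
  udalg_ext (dsOm D) (@chi0_deg0 i).
Definition JP (i : bI E) : dgideal (dsOm D) := ker_dgideal (chiOm i).

Definition GP : dga K := quotient_dga (cap_dgideal JP).

Definition chiG (i : bI E) : dgahom GP (Gloc i) :=
  @qlift_hom K (dsOm D) (cap_dgideal JP) (Gloc i) (chiOm i) (fun x Jx => Jx i).
Definition KP (i : bI E) : dgideal GP := ker_dgideal (chiG i).

(* g_i and g_j, seen in Gamma(P)/K_i and Gamma(P)/K_j through the surjections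
   chiG, have the same image in Gamma(P)/(K_i + K_j). *)
Definition Gc_compat (g : forall i, Gloc i) : Prop :=
  forall i j, exists x y : GP, [/\ chiG i x = g i, chiG j y = g j &
    qproj (sum_ideal (KP i) (KP j)) x = qproj (sum_ideal (KP i) (KP j)) y].

Lemma Gc_lin k g g' : Gc_compat g -> Gc_compat g' -> Gc_compat (fun i => k *: g i + g' i).
Proof.
move=> h h' i j; case: (h i j) (h' i j) => x [y [hx hy e]] [x' [y' [hx' hy' e']]].
exists (k *: x + x'), (k *: y + y'); split; rewrite ?alghom_lin ?hx ?hx' ?hy ?hy' //.
by rewrite !qproj_lin e e'.
Qed.
Lemma Gc_one : Gc_compat (fun i => \1).
Proof. by move=> i j; exists \1, \1; split; rewrite ?alghom_one. Qed.
Lemma Gc_mul g g' : Gc_compat g -> Gc_compat g' -> Gc_compat (fun i => g i ** g' i).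
Proof.
move=> h h' i j; case: (h i j) (h' i j) => x [y [hx hy e]] [x' [y' [hx' hy' e']]].
exists (x ** x'), (y ** y'); split; rewrite ?alghom_mul ?hx ?hx' ?hy ?hy' //.
by rewrite !qproj_mul e e'.
Qed.
Lemma Gc_pr n g : Gc_compat g -> Gc_compat (fun i => gpr n (g i)).
Proof.
move=> h i j; case: (h i j) => x [y [hx hy e]].
exists (gpr n x), (gpr n y); split; rewrite ?dgahom_pr ?hx ?hy //.
apply/qprojP; rewrite -(linB (gpr_lin n)).
by apply: (@dgideal_pr _ _ (sum_dgideal (KP i) (KP j))); apply/qprojP.
Qed.
Lemma Gc_d g : Gc_compat g -> Gc_compat (fun i => gdiff (g i)).
Proof.
move=> h i j; case: (h i j) => x [y [hx hy e]].
exists (gdiff x), (gdiff y); split; rewrite ?dgahom_d ?hx ?hy //.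
apply/qprojP; rewrite -(linB (@gdiff_lin _ _)).
by apply: (@dgideal_d _ _ (sum_dgideal (KP i) (KP j))); apply/qprojP.
Qed.
Definition Gc_sub : subproduct Gloc := SubProduct Gc_lin Gc_one Gc_mul Gc_pr Gc_d.

Definition Gc : dga K := subprod_dga Gc_sub.
Definition chic (i : bI E) (g : Gc) : Gloc i := spfam (g : subprod Gc_sub) i.

Lemma inP_subproof (f : bP E) : Gc_compat (fun i => chi0 i f).
Proof.
move=> i j; pose x : GP := qproj _ (dalg_in (dsOm D) f).
have hx k : chiG k x = chi0 k f.
  rewrite [LHS](qliftE (f := chiOm k))  => [|y Jy]; last exact: Jy.
  by rewrite /chiOm /udalg_ext; case: (cid _).
by exists x, x; split.
Qed.
Definition inP (f : bP E) : Gc := SubProd (S := Gc_sub) (inP_subproof f).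

Definition hor (g : Gc) : Prop :=
  forall i, exists t : tensor (dsB D i) (bH E),
    chic i g = tmap id (dalg_in (dsH D)) t.
Definition Gm (g : Gc) : Prop :=
  forall i, exists x : dsB D i, chic i g = x ⊗ \1.
Definition hor1 (g : Gc) : Prop := hor g /\ hdeg 1 g.

(* The local formula determines rho, the maps chic i being jointly injective. *)
Definition Gc_coaction (rho : Gc -> tensor Gc (bH E)) : Prop :=
  coaction rho /\
  forall i g, tmap (@chic i) id (rho g) = id_tens (@rc_co K _ (dsH D)) (chic i g).

(* (f ⊗ id) rho = rho f on a subcomodule S.  As f is meaningful on S only, f ⊗ id
   is evaluated on expansions of rho g in S ⊗ H; these exist because S is a
   subcomodule. *)
Definition colinear_on (rho : Gc -> tensor Gc (bH E)) (S : Gc -> Prop) (f : Gc -> Gc) :=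
  forall (g : Gc) (s : seq (Gc * bH E)), S g -> (forall p, p \in s -> S p.1) ->
    rho g = \sum_(p <- s) p.1 ⊗ p.2 -> rho (f g) = \sum_(p <- s) f p.1 ⊗ p.2.

Definition linear_on (S : Gc -> Prop) (f : Gc -> Gc) : Prop :=
  forall k x y, S x -> S y -> f (k *: x + y) = k *: f x + f y.
End DifferentialStructure.

Section GaugeTransformations.
Variables (K : fieldType).

Section Local.
Variables (A : ualgType K) (H : hopf K) (a : tensor A H -> tensor A H).

Definition left_gauge_loc : Prop :=
  [/\ linear a, bijective a,
      forall b x, a ((b ⊗ \1) ** x) = (b ⊗ \1) ** a x,
      forall x, tmap a id (id_tens (@cop K H) x) = id_tens (@cop K H) (a x) &
      forall b, a (b ⊗ \1) = b ⊗ \1].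

Definition right_gauge_loc : Prop :=
  [/\ linear a, bijective a,
      forall b x, a (x ** (b ⊗ \1)) = a x ** (b ⊗ \1),
      forall x, tmap a id (id_tens (@cop K H) x) = id_tens (@cop K H) (a x) &
      forall b, a (b ⊗ \1) = b ⊗ \1].
End Local.

Variables (E : bundle K) (a : bP E -> bP E).

Definition left_gauge : Prop :=
  [/\ linear a, bijective a,
      forall b f, a (biota E b ** f) = biota E b ** a f &
      forall i, exists2 ai, left_gauge_loc ai &
        forall f, @bchi K E i (a f) = ai (@bchi K E i f)].

Definition right_gauge : Prop :=
  [/\ linear a, bijective a,
      forall b f, a (f ** biota E b) = a f ** biota E b &
      forall i, exists2 ai, right_gauge_loc ai &
        forall f, @bchi K E i (a f) = ai (@bchi K E i f)].

(* g is the (unique) linear map g_a with a(f) = f_0 g(f_1), resp. g(f_1) f_0. *)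
Definition left_gauge_map (g : bH E -> bP E) : Prop :=
  linear g /\ forall f, a f = tlift (fun x h => x ** g h) (bDelta E f).
Definition right_gauge_map (g : bH E -> bP E) : Prop :=
  linear g /\ forall f, a f = tlift (fun x h => g h ** x) (bDelta E f).
End GaugeTransformations.

Section Connections.
Variables (K : fieldType) (E : bundle K) (D : dstruct E).
Variable rho : Gc D -> tensor (Gc D) (bH E).

(* The action on hor Gamma_c(P) of the gauge transformation with map g. *)
Definition left_act (g : bH E -> bP E) (x : Gc D) : Gc D :=
  tlift (fun y h => y ** inP D (g h)) (rho x).
Definition right_act (g : bH E -> bP E) (x : Gc D) : Gc D :=
  tlift (fun y h => inP D (g h) ** y) (rho x).

(* Maps on hor Gamma_c(P) and on the one-forms are represented by functions on
   Gamma_c(P) whose values elsewhere are irrelevant. *)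
Definition pre_covder (d : Gc D -> Gc D) : Prop :=
  [/\ forall x, hor x -> hor (d x),
      linear_on (@hor K E D) d,
      forall n x, hor x -> hdeg n x -> hdeg n.+1 (d x),
      d \1 = 0 /\ colinear_on rho (@hor K E D) d &
      forall i x, hor x -> chic i x = 0 -> chic i (d x) = 0].

Definition left_covder (d : Gc D -> Gc D) : Prop :=
  pre_covder d /\
  forall n r x, Gm r -> hdeg n r -> hor x ->
    d (r ** x) = gdiff r ** x + (-1) ^+ n *: (r ** d x).
Definition right_covder (d : Gc D -> Gc D) : Prop :=
  pre_covder d /\
  forall n r x, Gm r -> hor x -> hdeg n x ->
    d (x ** r) = d x ** r + (-1) ^+ n *: (x ** gdiff r).

Definition pre_connection (p : Gc D -> Gc D) : Prop :=
  [/\ linear_on (@hdeg K (Gc D) 1) p,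
      forall x, hdeg 1 x -> hor1 (p x),
      forall x, hor1 x -> p x = x,
      colinear_on rho (@hdeg K (Gc D) 1) p &
      forall i x, hdeg 1 x -> chic i x = 0 -> chic i (p x) = 0].

Definition left_connection (p : Gc D -> Gc D) : Prop :=
  pre_connection p /\ forall f x, hdeg 1 x -> p (inP D f ** x) = inP D f ** p x.
Definition right_connection (p : Gc D -> Gc D) : Prop :=
  pre_connection p /\ forall f x, hdeg 1 x -> p (x ** inP D f) = p x ** inP D f.

Definition left_covder_of (p d : Gc D -> Gc D) : Prop :=
  left_covder d /\ forall f, d (inP D f) = p (gdiff (inP D f)).
Definition right_covder_of (p d : Gc D -> Gc D) : Prop :=
  right_covder d /\ forall f, d (inP D f) = p (gdiff (inP D f)).
End Connections.

(* Main.v *)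
From HB Require Import structures.
Require Import Defs.
From mathcomp Require Import all_boot all_order all_algebra.
From mathcomp Require Import boolp classical_sets reals complex.

(* Locally a horizontal form is a sum of products (x ⊗ 1) chi_i(f), on which a
   gauge transformation acts through f only; hence conjugation by it preserves the
   axioms of a covariant derivative.  It remains to see that, when Gamma(H) is
   universal, every covariant derivative D comes from a connection.  A one-form is
   locally a sum of products chi_i(f) d chi_i(h), and the connection must send it
   to the sum of chi_i(f) chi_i(D h).  This is well defined: D is prescribed by the
   Leibniz rule on B_i ⊗ 1 and arbitrary on 1 ⊗ H, and a linear map on H vanishing
   at 1 extends from dH to a module map on the one-forms of the universal Gamma(H).
   Both sums come from Gamma(P) and Gamma_c(P), so that the local projections
   glue. *)

Set Implicit Arguments.
Unset Strict Implicit.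
Unset Printing Implicit Defensive.
Import GRing.Theory.
Local Open Scope ring_scope.

(** * Linear and bilinear maps on tensor products *)

Section LinearMaps.
Variable K : fieldType.
Implicit Types U V W : lmodType K.

Lemma linear_id V : linear (@id V).
Proof. by []. Qed.

Lemma linear_comp U V W (f : V -> W) (g : U -> V) :
  linear f -> linear g -> linear (f \o g).
Proof. by move=> fL gL k x y /=; rewrite gL fL. Qed.

Lemma bilin_comp U U' V V' W (F : V -> V' -> W) (f : U -> V) (g : U' -> V') :
  bilin F -> linear f -> linear g -> bilin (fun x y => F (f x) (g y)).
Proof.
by move=> [Fl Fr] fL gL; split=> z k x y; rewrite ?fL ?gL ?Fl ?Fr.
Qed.

Lemma linear_bilin U U' V W (f : V -> W) (F : U -> U' -> V) :
  linear f -> bilin F -> bilin (fun x y => f (F x y)).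
Proof. by move=> fL [Fl Fr]; split=> z k x y; rewrite ?Fl ?Fr fL. Qed.

Lemma lin_tlift V W U U' (f : U -> U') (F : V -> W -> U) x :
  linear f -> f (tlift F x) = tlift (fun v w => f (F v w)) x.
Proof. by move=> fL; rewrite /tlift (lin_sum fL). Qed.

Lemma eq_tlift V W U (F G : V -> W -> U) x :
  (forall v w, F v w = G v w) -> tlift F x = tlift G x.
Proof. by move=> FG; apply: eq_bigr => p _. Qed.

Lemma tlift_tmap V W V' W' U (F : V' -> W' -> U) (f : V -> V') (g : W -> W') x :
  bilin F -> linear f -> linear g ->
  tlift F (tmap f g x) = tlift (fun v w => F (f v) (g w)) x.
Proof.
move=> FB fL gL; rewrite /tmap (lin_tlift _ _ (tlift_lin FB)).
by apply: eq_tlift => v w; rewrite (tliftE FB).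
Qed.

Lemma tmap_comp V W V' W' V2 W2 (f' : V' -> V2) (g' : W' -> W2)
    (f : V -> V') (g : W -> W') x :
  linear f' -> linear g' -> linear f -> linear g ->
  tmap f' g' (tmap f g x) = tmap (f' \o f) (g' \o g) x.
Proof. by move=> *; apply: tlift_tmap => //; apply: tmap_bilin. Qed.

Lemma eq_tmap V W V' W' (f f' : V -> V') (g g' : W -> W') x :
  f =1 f' -> g =1 g' -> tmap f g x = tmap f' g' x.
Proof. by move=> ff gg; apply: eq_tlift => v w; rewrite ff gg. Qed.

Lemma tmap_id V W (x : tensor V W) : tmap id id x = x.
Proof. by rewrite {2}[x]tensE. Qed.

Lemma tens_eq_bilin V W V' W' U (F G : tensor V W -> tensor V' W' -> U) :
  bilin F -> bilin G ->
  (forall v w v' w', F (v ⊗ w) (v' ⊗ w') = G (v ⊗ w) (v' ⊗ w')) ->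
  forall x y, F x y = G x y.
Proof.
move=> [Fl Fr] [Gl Gr] FG x y.
apply: (tens_eq_lin (f := F^~ y) (g := G^~ y)) => [||v w]; [exact: Fl|exact: Gl|].
by apply: (tens_eq_lin (f := F (v ⊗ w)) (g := G (v ⊗ w))).
Qed.

(** The function lifted in the definition of [tassoc] is convertible to this one, so the linearity
    of [tassoc] and its value on [v ⊗ t] follow at once. *)
Lemma tmap_tens_bilin V W U :
  bilin (fun v : V => tmap (tens v) id : tensor W U -> tensor (tensor V W) U).
Proof.
split=> [t k x x'|x]; last exact: tmap_lin (tens_linr x) (@linear_id U).
have L y := tmap_lin (tens_linr y) (@linear_id U).
apply: (tens_eq_lin (f := tmap (tens (k *: x + x')) id)
  (g := fun t => k *: tmap (tens x) id t + tmap (tens x') id t)) => [|l t1 t2|w u].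
- exact: L.
- by rewrite !L !scalerDr !scalerA addrACA mulrC.
- by rewrite !tmapE ?tens_linl //; apply: tens_linr.
Qed.

Lemma tassoc_lin V W U : linear (@tassoc K V W U).
Proof. exact: tlift_lin (@tmap_tens_bilin V W U). Qed.

Lemma tassoc_tens V W U (v : V) (t : tensor W U) :
  tassoc (v ⊗ t) = tmap (tens v) id t.
Proof. exact: tliftE (@tmap_tens_bilin V W U) v t. Qed.

Lemma id_tens_lin V W U (f : W -> tensor W U) : linear f -> linear (@id_tens K V W U f).
Proof.
move=> fL; apply: (linear_comp (f := @tassoc K V W U)); first exact: tassoc_lin.
exact: tmap_lin.
Qed.

Lemma id_tensE V W U (f : W -> tensor W U) (v : V) (w : W) : linear f ->
  id_tens f (v ⊗ w) = tmap (tens v) id (f w).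
Proof. by move=> fL; rewrite /id_tens tmapE // tassoc_tens. Qed.
End LinearMaps.

(** * Separation of the elements of a tensor product by functionals *)

Section Separation.
Local Open Scope classical_set_scope.
Variable K : fieldType.

(** A subspace [M] maximal among those avoiding [v0] is a complement of the line through [v0]; [phi]
    reads off the coefficient along this line. *)
Lemma separating_functional (V : lmodType K) (v0 : V) : v0 != 0 ->
  exists2 phi : V -> K, scalar phi & phi v0 = 1.
Proof.
move=> v0N0.
(* [P] has to hold for the union of the empty chain and hence does not ask for 0; maximality puts 0
   into [M] afterwards. *)
pose P (M : set V) := (forall k x y, M x -> M y -> M (k *: x + y)) /\ ~ M v0.
have [F FP Ftot|M [[Mlin Mv0] Mmax]] := @Zorn_bigcup V P.
  split=> [k x y [X FX Xx] [Y FY Yy]|[X FX Xv0]]; last by case: (FP X FX).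
  have [XY|YX] := Ftot X Y FX FY.
    by exists Y => //; apply: (FP Y FY).1 => //; apply: XY.
  by exists X => //; apply: (FP X FX).1 => //; apply: YX.
have M0 : M 0.
  apply: contrapT => nM0; apply: (Mmax [set 0]).
    split=> [|MM]; last by apply: nM0; apply: MM.
    by move=> x Mx; case: nM0; have := Mlin (-1) _ _ Mx Mx; rewrite scaleN1r addNr.
  split=> [k x y -> ->|/eqP]; first by rewrite /= scaler0 addr0.
  by rewrite (negbTE v0N0).
have M_eq x y : x = y -> M x -> M y by move=> ->.
have MZ k x : M x -> M (k *: x).
  by move=> Mx; have := Mlin k _ _ Mx M0; rewrite addr0.
(* Otherwise the span of [M] and [w] would be a larger subspace that still avoids [v0]. *)
have ex w : exists c, M (w - c *: v0).
  apply: contrapT => nex.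
  have nMw : ~ M w by move=> Mw; apply: nex; exists 0; rewrite scale0r subr0.
  apply: (Mmax [set x | exists c, M (x - c *: w)]).
    split=> [x Mx|MM]; first by exists 0; rewrite scale0r subr0.
    by apply: nMw; apply: MM; exists 1; rewrite scale1r subrr.
  split=> [k x y [c Mx] [c' My]|[c Mc]].
    exists (k * c + c'); apply: M_eq (Mlin k _ _ Mx My).
    by rewrite scalerBr scalerDl scalerA addrACA opprD.
  have [c0|cN0] := eqVneq c 0; first by apply: Mv0; rewrite c0 scale0r subr0 in Mc.
  apply: nex; exists c^-1; apply: M_eq (MZ (- c^-1) _ Mc).
  by rewrite scalerBr !scaleNr scalerA mulVf // scale1r opprK addrC.
have un w c c' : M (w - c *: v0) -> M (w - c' *: v0) -> c = c'.
  move=> Mc Mc'; apply/eqP/negPn/negP => cc'; apply: Mv0.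
  have cN0 : c' - c != 0 by rewrite subr_eq0 eq_sym.
  apply: M_eq (MZ (c' - c)^-1 _ (Mlin (-1) _ _ Mc' Mc)).
  by rewrite scaleN1r opprB addrA subrK -scalerBl scalerA mulVf ?scale1r.
pose phi w := sval (cid (ex w)).
have phiP w : M (w - phi w *: v0) by rewrite /phi; case: cid.
exists phi; last by apply: un (phiP _) _; rewrite scale1r subrr.
move=> k x y; apply: un (phiP _) _; apply: M_eq (Mlin k _ _ (phiP x) (phiP y)).
by rewrite scalerBr scalerDl scalerA addrACA opprD.
Qed.

(* A term v ⊗ w is eliminated by a functional with value 1 at w: it
   expresses v through the other left factors. *)
Lemma tens_separated (V W : lmodType K) (x : tensor V W) :
  (forall phi : W -> K, scalar phi -> tlift (fun v w => phi w *: v) x = 0) -> x = 0.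
Proof.
have phiB (phi : W -> K) : scalar phi -> bilin (fun (v : V) w => phi w *: v).
  move=> phiL; split=> [w k v v'|v k w w'].
    by rewrite scalerDr !scalerA mulrC.
  by rewrite phiL scalerDl scalerA.
case: (tensP x) => s ->{x}; move: {2}(size s) (erefl (size s)) => n.
elim: n s => [|n IH] [|[v w] s] //.
move=> [sn] h.
have [w0|wN0] := eqVneq w 0.
  rewrite tclsE big_cons w0 (lin0 (tens_linr _)) add0r -tclsE; apply: IH => // phi phiL.
  have := h _ phiL; rewrite !tlift_tcls ?big_cons /=; try exact: phiB.
  have -> : phi w = 0 by have := phiL (-1) w w; rewrite scaleN1r addNr mulN1r addNr w0.
  by rewrite scale0r add0r.
have [psi psiL psiw] := separating_functional wN0.
have := h _ psiL; rewrite tlift_tcls ?big_cons /= ?psiw ?scale1r; last exact: phiB.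
move/eqP; rewrite addr_eq0 => /eqP vE.
have xE : tcls ((v, w) :: s) = tcls [seq (p.1, p.2 - psi p.2 *: w) | p <- s].
  rewrite !tclsE big_cons big_map /= vE (linN (tens_linl _)) (lin_sum (tens_linl _)).
  rewrite addrC -sumrB; apply: eq_bigr => p _.
  by rewrite (linB (tens_linr _)) (linZ (tens_linr _)) (linZ (tens_linl _)).
rewrite xE; apply: IH; first by rewrite size_map.
by move=> phi phiL; rewrite -xE; apply: h.
Qed.

(** Contracting the second factor with a functional commutes with every [f i]. Hence each
    contraction of [x - y] is killed by all [f i] and vanishes, and contractions separate
    tensors. *)
Lemma tmap_jointly_injective (I : Type) (V W : lmodType K) (U : I -> lmodType K)
    (f : forall i, V -> U i) : (forall i, linear (f i)) ->
  (forall v, (forall i, f i v = 0) -> v = 0) ->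
  forall x y : tensor V W,
    (forall i, tmap (f i) id x = tmap (f i) id y) -> x = y.
Proof.
move=> fL finj x y xy; apply/eqP; rewrite -subr_eq0; apply/eqP.
apply: tens_separated => phi phiL; apply: finj => i.
have phiB (X : lmodType K) : bilin (fun (v : X) w => phi w *: v).
  split=> [w k v v'|v k w w'].
    by rewrite scalerDr !scalerA mulrC.
  by rewrite phiL scalerDl scalerA.
rewrite lin_tlift //; under eq_tlift => v w do rewrite (linZ (fL i)).
rewrite -(tlift_tmap _ (phiB (U i)) (fL i) (@linear_id K W)).
rewrite (linB (tmap_lin (fL i) (@linear_id K W))) xy subrr.
exact: lin0 (tlift_lin (phiB _)).
Qed.
End Separation.

(* The product of A for s = true, and that of its opposite algebra for s = false:
   left and right structures are treated at once. *)
Definition smul (K : fieldType) (A : ualgType K) (s : bool) (x y : A) : A :=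
  if s then x ** y else y ** x.

(** * Rules for the sided product *)

Section SidedProduct.
Variables (K : fieldType) (s : bool).
Implicit Types A B : ualgType K.

Lemma smul_bilin A : bilin (@smul K A s).
Proof.
rewrite /smul; case: s; split=> x k y z /=;
  by [apply: amul_linl | apply: amul_linr].
Qed.

Lemma smul_linl A (y : A) : linear (fun x => smul s x y).
Proof. exact: (@smul_bilin A).1. Qed.

Lemma smul_linr A (x : A) : linear (smul s x).
Proof. exact: (@smul_bilin A).2. Qed.

Lemma smulA A (x y z : A) : smul s x (smul s y z) = smul s (smul s x y) z.
Proof. by rewrite /smul; case: s; rewrite amulA. Qed.

Lemma smul1l A (x : A) : smul s \1 x = x.
Proof. by rewrite /smul; case: s; rewrite ?amul1l ?amul1r. Qed.

Lemma smul1r A (x : A) : smul s x \1 = x.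
Proof. by rewrite /smul; case: s; rewrite ?amul1l ?amul1r. Qed.

Lemma smul_tens A B (a c : A) (b d : B) :
  smul s (a ⊗ b) (c ⊗ d) = smul s a c ⊗ smul s b d.
Proof. by rewrite /smul; case: s; rewrite tmulE. Qed.

Lemma alghom_smul A B (f : alghom A B) x y : f (smul s x y) = smul s (f x) (f y).
Proof. by rewrite /smul; case: s; rewrite alghom_mul. Qed.

Lemma hdeg_smul (G : dga K) m n (x y : G) :
  hdeg m x -> hdeg n y -> hdeg (m + n) (smul s x y).
Proof.
rewrite /smul; case: s => xm yn; first exact: hdegM.
by rewrite addnC; apply: hdegM.
Qed.

Lemma gtmul_deg0 (G1 G2 : dga K) (a c : G1) (b d : G2) : hdeg 0 b \/ hdeg 0 c ->
  gtens a b ** gtens c d = gtens (a ** c) (b ** d).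
Proof.
have S n x : (-1) ^+ (0 * n) *: (x : gtensor G1 G2) = x by rewrite scale1r.
have S' n x : (-1) ^+ (n * 0) *: (x : gtensor G1 G2) = x by rewrite muln0 scale1r.
case=> [b0|c0].
  elim/hdeg_ind: c => [|c c' h h'|n c cn]; last by rewrite (gtmulE _ _ b0 cn) S.
    by rewrite amul0r /gtens !(lin0 (tens_linl _)) amul0r.
  rewrite amulDr /gtens !(linD (tens_linl _)).
  by rewrite (amulDr (gtens a b : gtensor G1 G2)) [X in X + _]h [X in _ + X]h'.
elim/hdeg_ind: b => [|b b' h h'|n b bn]; last by rewrite (gtmulE _ _ bn c0) S'.
  by rewrite amul0l /gtens !(lin0 (tens_linr _)) amul0l.
rewrite amulDl /gtens !(linD (tens_linr _)).
by rewrite (amulDl (gtens a b : gtensor G1 G2)) [X in X + _]h [X in _ + X]h'.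
Qed.

(** The sign depends on the two inner factors, which are [b] and [c] for [s = true], but [d] and [a]
    for [s = false]; the hypotheses make one of them of degree 0 in both cases. *)
Lemma smul_gtens (G1 G2 : dga K) (a c : G1) (b d : G2) :
  hdeg 0 b -> hdeg 0 a \/ hdeg 0 d ->
  smul s (gtens a b : gtensor G1 G2) (gtens c d) = gtens (smul s a c) (smul s b d).
Proof.
rewrite /smul; case: s => b0 ad; apply: gtmul_deg0; first by left.
by case: ad; [right|left].
Qed.
End SidedProduct.

(** * One-forms of a differential algebra as sums of products of functions and differentials *)

Section OneForms.
Variables (K : fieldType) (s : bool).

Lemma gpr_mul1 (G : dga K) (x y : G) :
  gpr 1 (x ** y) = gpr 1 x ** gpr 0 y + gpr 0 x ** gpr 1 y.
Proof.
elim/hdeg_ind: x => [|x x' h h'|m x xm].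
- by rewrite amul0l !(lin0 (gpr_lin _)) !amul0l addr0.
- by rewrite amulDl !(linD (gpr_lin _)) !amulDl h h' addrACA.
elim/hdeg_ind: y => [|y y' h h'|n y yn].
- by rewrite amul0r !(lin0 (gpr_lin _)) !amul0r addr0.
- by rewrite amulDr !(linD (gpr_lin _)) !amulDr h h' addrACA.
rewrite (hdegE _ (hdegM xm yn)) !(hdegE _ xm) !(hdegE _ yn).
by case: m xm n yn => [|[|m]] _ [|[|n]] _; rewrite /= ?(amul0l, amul0r) ?(addr0, add0r).
Qed.

Variables (A : ualgType K) (G : dalg A).

Definition one_form (x : G) : Prop := exists l : seq (A * A),
  x = \sum_(p <- l) smul s (dalg_in G p.1) (gdiff (dalg_in G p.2)).

Lemma one_form_lin k x y : one_form x -> one_form y -> one_form (k *: x + y).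
Proof.
move=> [l ->] [l' ->]; exists ([seq (k *: p.1, p.2) | p <- l] ++ l').
rewrite big_cat big_map /= scaler_sumr; congr (_ + _); apply: eq_bigr => p _.
by rewrite (linZ (alghom_lin _)) (linZ (smul_linl s _)).
Qed.

Lemma one_form_sum (I : Type) (l : seq I) (F : I -> G) :
  (forall i, one_form (F i)) -> one_form (\sum_(i <- l) F i).
Proof.
move=> FO; elim: l => [|i l IH]; first by exists [::]; rewrite !big_nil.
by rewrite big_cons -[F i]scale1r; apply: one_form_lin.
Qed.

Lemma gdiff_in a b : gdiff (dalg_in G (a ** b)) =
  gdiff (dalg_in G a) ** dalg_in G b + dalg_in G a ** gdiff (dalg_in G b).
Proof. by rewrite alghom_mul (gdiff_mul _ (dalg_in_deg0 G a)) expr0 scale1r. Qed.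

(** If [a] multiplies on the side of the differentials, the Leibniz rule brings it inside: (b dc) a
    = b d(ca) - bc da, and symmetrically a (dc) b = d(ac) b - (da) cb. *)
Lemma one_form_mul t a x : one_form x -> one_form (smul t (dalg_in G a) x).
Proof.
move=> [l ->]; rewrite (lin_sum (smul_linr t _)); apply: one_form_sum => -[b c] /=.
have [->|] := eqVneq t s.
  by exists [:: (smul s a b, c)]; rewrite big_seq1 /= alghom_smul smulA.
move=> ts; exists [:: (b, smul t a c); (- smul s b c, a)].
rewrite !big_cons big_nil /= addr0 !alghom_smul (linN (alghom_lin _)) alghom_smul.
move: ts; rewrite /smul; case: t s => -[] // _; rewrite -!alghom_mul gdiff_in.
  by rewrite alghom_mul !(amulDl, amulDr, amulNl, amulNr) !amulA [X in _ = X - _]addrC addrK.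
by rewrite alghom_mul !(amulDl, amulDr, amulNl, amulNr) !amulA addrK.
Qed.

(** The elements whose component of degree 1 is such a sum form a subalgebra, because the components
    of degree 0 lie in [A]. It contains [A] and its differentials, which generate. *)
Lemma hdeg1_one_form x : hdeg 1 x -> one_form x.
Proof.
move=> <-; move: x; apply: (@dalg_gen _ _ G (fun x => one_form (gpr 1 x))).
- split=> [|k x y|x y hx hy].
  + by exists [::]; rewrite big_nil (hdegE _ (hdeg_one G)).
  + by rewrite (gpr_lin 1); apply: one_form_lin.
  rewrite gpr_mul1.
  have [a ->] := (dalg_deg0 (gpr 0 x)).1 (hdeg_gpr 0 x).
  have [b ->] := (dalg_deg0 (gpr 0 y)).1 (hdeg_gpr 0 y).
  rewrite -[X in X + _]scale1r; apply: one_form_lin.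
    exact: (one_form_mul false b hx).
  exact: (one_form_mul true a hy).
- by move=> a; exists [::]; rewrite big_nil (hdegE _ (dalg_in_deg0 G a)).
- move=> a; rewrite (hdegE _ (gdiff_deg (dalg_in_deg0 G a))) eqxx.
  by exists [:: (\1, a)]; rewrite big_seq1 /= alghom_one smul1l.
Qed.
End OneForms.

(* The universal differential calculus truncated above degree 1: A ⊗ A is the
   bimodule of one-forms, with d a = 1 ⊗ a - a ⊗ 1. *)
Section TruncatedCalculus.
Variables (K : fieldType) (A : ualgType K).

Definition tcalc : Type := A * tensor A A.
HB.instance Definition _ := GRing.Lmodule.on tcalc.

(** The outer bimodule structure of A ⊗ A is expressed through the product of the algebra A ⊗ A; the
    product of two one-forms is 0. *)
Definition tc_mul (x y : tcalc) : tcalc :=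
  (x.1 ** y.1, (x.1 ⊗ \1) ** y.2 + x.2 ** (\1 ⊗ y.1)).

Lemma tc_mulA : associative tc_mul.
Proof.
move=> [a t] [b u] [c v]; rewrite /tc_mul /= amulA; congr pair.
by rewrite amulDl amulDr -(amulA t) amulA !tmulE !amul1l amulA addrA.
Qed.
Lemma tc_mul1l : left_id ((\1, 0) : tcalc) tc_mul.
Proof. by move=> [a t]; rewrite /tc_mul /= amul0l addr0 !amul1l. Qed.
Lemma tc_mul1r : right_id ((\1, 0) : tcalc) tc_mul.
Proof. by move=> [a t]; rewrite /tc_mul /= amul0r add0r !amul1r. Qed.
Lemma tc_mulDl : left_distributive tc_mul +%R.
Proof.
move=> [a t] [b u] [c v]; apply: (congr2 pair); first exact: amulDl.
by rewrite /= (linD (tens_linl _)) !amulDl addrACA.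
Qed.
Lemma tc_mulDr : right_distributive tc_mul +%R.
Proof.
move=> [a t] [b u] [c v]; apply: (congr2 pair); first exact: amulDr.
by rewrite /= (linD (tens_linr _)) !amulDr addrACA.
Qed.
Lemma tc_mulZl (k : K) x y : tc_mul (k *: x) y = k *: tc_mul x y.
Proof.
case: x y => [a t] [b u]; apply: (congr2 pair); first exact: amulZl.
by rewrite /= (linZ (tens_linl _)) !amulZl scalerDr.
Qed.
Lemma tc_mulZr (k : K) x y : tc_mul x (k *: y) = k *: tc_mul x y.
Proof.
case: x y => [a t] [b u]; apply: (congr2 pair); first exact: amulZr.
by rewrite /= (linZ (tens_linr _)) !amulZr scalerDr.
Qed.
HB.instance Definition _ := isUAlg.Build K tcalc
  tc_mulA tc_mul1l tc_mul1r tc_mulDl tc_mulDr tc_mulZl tc_mulZr.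

Definition tc_pr (n : nat) (x : tcalc) : tcalc :=
  (if n == 0 then x.1 else 0, if n == 1 then x.2 else 0).
Definition tc_d (x : tcalc) : tcalc := (0, \1 ⊗ x.1 - x.1 ⊗ \1).

Lemma tc_pr_lin n : linear (tc_pr n).
Proof.
by move=> k [a t] [b u]; apply: (congr2 pair) => /=; case: eqP => // _;
  rewrite scaler0 addr0.
Qed.
Lemma tc_pr_pr m n x : tc_pr m (tc_pr n x) = if m == n then tc_pr n x else 0.
Proof.
case: x => a t; rewrite /tc_pr /=.
case: (altP (m =P n)) => [->|mn]; first by congr pair; case: eqP.
apply: (congr2 pair).
  by case: eqP => // m0; case: eqP => // n0; rewrite m0 n0 in mn.
by case: eqP => // m1; case: eqP => // n1; rewrite m1 n1 in mn.
Qed.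
Lemma tc_pr_sum x : exists N, x = \sum_(n < N) tc_pr n x.
Proof.
case: x => a t; exists 2; rewrite big_ord_recl big_ord1.
by apply: (congr2 pair); rewrite /= ?addr0 ?add0r.
Qed.
Lemma tc_pr_one : tc_pr 0 \1 = \1.
Proof. by []. Qed.
Lemma tc_pr_mul m n (x y : tcalc) : tc_pr m x = x -> tc_pr n y = y ->
  tc_pr (m + n) (x ** y) = x ** y.
Proof.
case: x y => [a t] [b u] [<- <-] [<- <-].
case: m n => [|[|m]] [|[|n]]; apply: (congr2 pair);
  rewrite /= ?(lin0 (tens_linl _)) ?(lin0 (tens_linr _)) ?(amul0l, amul0r) ?addr0 //.
Qed.
Lemma tc_d_lin : linear tc_d.
Proof.
move=> k [a t] [b u]; apply: (congr2 pair); first by rewrite /= scaler0 addr0.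
by rewrite /= tens_linl tens_linr scalerBr opprD addrACA.
Qed.
Lemma tc_d_deg n x : tc_pr n x = x -> tc_pr n.+1 (tc_d x) = tc_d x.
Proof.
case: x => a t [<- _]; apply: (congr2 pair) => //=; case: n => //= n.
by rewrite (lin0 (tens_linl _)) (lin0 (tens_linr _)) subrr.
Qed.
Lemma tc_d_mul n (x y : tcalc) : tc_pr n x = x ->
  tc_d (x ** y) = tc_d x ** y + (-1) ^+ n *: (x ** tc_d y).
Proof.
case: x y => a t [b u] [<- <-]; apply: (congr2 pair) => /=.
  by rewrite amul0l amul0r scaler0 addr0.
case: n => [|n] /=; last first.
  by rewrite ?(lin0 (tens_linl _)) ?(lin0 (tens_linr _)) ?(amul0l, amul0r)
    ?(lin0 (tens_linl _)) ?(lin0 (tens_linr _)) ?(amul0l, amul0r) ?subrr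
    ?(amul0l, amul0r) ?addr0 ?scaler0 ?addr0.
rewrite scale1r !(lin0 (tens_linl _), lin0 (tens_linr _)) !(amul0l, amul0r).
rewrite add0r addr0 amulBl amulBr !tmulE !amul1l !amul1r.
by rewrite addrA subrK.
Qed.
Lemma tc_d_d x : tc_d (tc_d x) = 0.
Proof.
by apply: (congr2 pair) => //=; rewrite (lin0 (tens_linl _)) (lin0 (tens_linr _)) subrr.
Qed.
Definition tcalc_dga : dga K := DGA tc_pr_lin tc_pr_pr tc_pr_sum tc_pr_one
  tc_pr_mul tc_d_lin tc_d_deg tc_d_mul tc_d_d.

Lemma tc_in_lin : linear (fun a : A => (a, 0) : tcalc).
Proof. by move=> k a b; apply: (congr2 pair) => //=; rewrite scaler0 addr0. Qed.
Lemma tc_in_mul : {morph (fun a : A => (a, 0) : tcalc) : a b / a ** b}.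
Proof. by move=> a b; apply: (congr2 pair) => //=; rewrite amul0l amul0r addr0. Qed.
Definition tc_in : alghom A tcalc_dga := AlgHom tc_in_lin tc_in_mul erefl.
End TruncatedCalculus.

(* One-forms of the universal calculus are free, both as a left and as a right
   module, over the differentials of a complement of the constants. *)
Lemma universal_one_forms (K : fieldType) (s : bool) (A U : ualgType K) (G : dalg A)
    (iota : alghom A U) (f : A -> U) : universal G -> linear f -> f \1 = 0 ->
  exists th : G -> U, [/\ linear th, forall a, th (dalg_in G a) = 0 &
    forall a b, th (smul s (dalg_in G a) (gdiff (dalg_in G b))) = smul s (iota a) (f b)].
Proof.
move=> /(_ (tcalc_dga A) (tc_in A)) [//|F Fin] fL f1.
have FM a b : F (smul s (dalg_in G a) (gdiff (dalg_in G b))) =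
    (0, if s then a ⊗ b - (a ** b) ⊗ \1 else \1 ⊗ (b ** a) - b ⊗ a) :> tcalc A.
  rewrite alghom_smul dgahom_d !Fin /smul; case: s; apply: (congr2 pair) => /=;
    by rewrite ?(amul0l, amul0r) ?(add0r, addr0) ?(amulBl, amulBr) ?tmulE ?(amul1l, amul1r).
(* In both cases [f \1 = 0] removes the term of [FM] that does not contain the factors [a] and [b]
   separately; for [s = false] the minus sign cancels the one in front of [b ⊗ a]. *)
pose g (x y : A) : U := if s then iota x ** f y else - (f x ** iota y).
have gB : bilin g.
  rewrite /g; case: (s); split=> z k x y.
  - by rewrite alghom_lin amulDl amulZl.
  - by rewrite fL amulDr amulZr.
  - by rewrite fL amulDl amulZl opprD scalerN.
  - by rewrite alghom_lin amulDr amulZr opprD scalerN.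
exists (fun x => tlift g (F x : tcalc A).2); split.
- by move=> k x y; rewrite alghom_lin /= (tlift_lin gB).
- by move=> a; rewrite Fin; apply: lin0 (tlift_lin gB).
move=> a b; rewrite FM {FM} /smul /g; move: gB; rewrite /g; case: (s) => gB /=;
  rewrite (linB (tlift_lin gB)) !(tliftE gB) f1.
  by rewrite amul0r subr0.
by rewrite amul0l oppr0 sub0r opprK.
Qed.

(** * Coaction, horizontal forms, gauge action and connections over a trivial piece *)

Section LocalForms.
Variables (K : fieldType) (A : ualgType K) (G : dalg A) (H : hopf K) (GH : rcdalg H).
Variable s : bool.

Local Notation L := (gtensor_dga G GH).
Local Notation incl := (gt_in_hom G GH).
Local Notation inA := (dalg_in G).
Local Notation inH := (dalg_in GH).

Definition loc_co : L -> tensor L H := id_tens (@rc_co K H GH).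

Definition loc_hor (z : L) : Prop := exists t : tensor G H, z = tmap id inH t.

Let rcL : linear (@rc_co K H GH). Proof. exact: alghom_lin. Qed.
Let inHL : linear inH. Proof. exact: alghom_lin. Qed.
Let idL (V : lmodType K) : linear (@id V). Proof. by []. Qed.
Let gtL (x : G) : linear (gtens x : GH -> L). Proof. exact: tens_linr. Qed.

Lemma loc_co_lin : linear loc_co.
Proof. exact: id_tens_lin. Qed.

Lemma loc_coE x w : loc_co (gtens x w) = tmap (gtens x : GH -> L) id (rc_co GH w).
Proof. exact: (id_tensE (V := G) x w rcL). Qed.

Lemma incl_tens a h : incl (a ⊗ h) = gtens (inA a) (inH h).
Proof. exact: gt_inE. Qed.

Lemma loc_co_in u : loc_co (incl u) = tmap incl id (id_tens (@cop K H) u).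
Proof.
have copL : linear (@cop K H) by exact: alghom_lin.
have inclL : linear incl by exact: alghom_lin.
apply: (tens_eq_lin (f := fun u => loc_co (incl u))
  (g := fun u => tmap incl id (id_tens (@cop K H) u))) => [||a h].
- exact: linear_comp loc_co_lin inclL.
- exact: linear_comp (tmap_lin inclL (@idL _)) (id_tens_lin copL).
rewrite incl_tens loc_coE rc_in id_tensE // !tmap_comp //; last exact: tens_linr.
by apply: eq_tmap => // k; apply/esym/gt_inE.
Qed.

Lemma gdiff_tens (x : G) (w : GH) :
  gdiff (gtens x w : L) = gtens (gdiff x) w + gtens (gsgn x) (gdiff w).
Proof.
rewrite -[LHS]/(gt_diff (gtens x w)) /gt_diff /gtens !tmapE //;
  by [apply: gdiff_lin | apply: gsgn_lin].
Qed.

(** The coaction only concerns the second factor, where it commutes with the differential because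
    Gamma(H) is covariant, whereas the sign in the differential only depends on the first. *)
Lemma loc_co_d z : loc_co (gdiff z) = tmap gdiff id (loc_co z).
Proof.
have dL : linear (@gdiff K L) by exact: gdiff_lin.
have dHL : linear (@gdiff K GH) by exact: gdiff_lin.
move: z; apply: tens_eq_lin => [||x w].
- exact: linear_comp loc_co_lin dL.
- exact: linear_comp (tmap_lin dL (@idL _)) loc_co_lin.
have -> : gdiff (x ⊗ w : L) = gtens (gdiff x) w + gtens (gsgn x) (gdiff w) :> L.
  exact: gdiff_tens.
rewrite (linD loc_co_lin) !loc_coE rc_d !tmap_comp //.
have dxL : linear ((gdiff : L -> L) \o (gtens x : GH -> L)) by exact: linear_comp.
have dsL : linear ((gtens (gsgn x) : GH -> L) \o gdiff) by exact: linear_comp.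
apply: (tens_eq_lin (f := fun Y => tmap (gtens (gdiff x) : GH -> L) id Y +
    tmap ((gtens (gsgn x) : GH -> L) \o gdiff) (id \o id) Y)) => [||{}w h].
- move=> k Y Y'; rewrite (tmap_lin (@gtL _) (@idL _)) (tmap_lin dsL (@idL _)).
  by rewrite scalerDr addrACA.
- exact: tmap_lin.
by rewrite !tmapE // -(linD (tens_linl _)) -gdiff_tens.
Qed.

(** The coaction on Gamma(H) is an algebra homomorphism, and no sign occurs since [incl u] has
    degree 0. *)
Lemma loc_co_smul u z :
  loc_co (smul s (incl u) z) = smul s (loc_co (incl u)) (loc_co z).
Proof.
have inclL : linear incl by exact: alghom_lin.
apply: (tens_eq_bilin (F := fun u (z : tensor G GH) => loc_co (smul s (incl u) z))
  (G := fun u (z : tensor G GH) => smul s (loc_co (incl u)) (loc_co z))) => [||a h x w].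
- apply: linear_bilin loc_co_lin _.
  exact: (bilin_comp (smul_bilin s L) inclL (@idL _)).
- apply: bilin_comp (smul_bilin s _) _ loc_co_lin.
  exact: linear_comp loc_co_lin inclL.
have a0 := dalg_in_deg0 G a; have h0 := dalg_in_deg0 GH h.
rewrite incl_tens [X in loc_co X]smul_gtens; try by [|left].
rewrite !loc_coE alghom_smul rc_in tmap_comp // ?id_tensE //.
set X := cop H h; set Y := rc_co GH w.
have inXL : linear ((gtens (inA a) : GH -> L) \o inH) by exact: linear_comp.
apply: (tens_eq_bilin (F := fun X Y =>
    tmap (gtens (smul s (inA a) x) : GH -> L) id (smul s (tmap inH id X) Y))
  (G := fun X Y => smul s (tmap ((gtens (inA a) : GH -> L) \o inH) (id \o id) X)
    (tmap (gtens x : GH -> L) id Y))) => [||k l w' m].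
- apply: linear_bilin; first exact: tmap_lin.
  exact: (bilin_comp (smul_bilin s _) (tmap_lin inHL (@idL _)) (@idL _)).
- by apply: (bilin_comp (smul_bilin s _)); apply: tmap_lin.
rewrite !tmapE // !smul_tens tmapE //= [X in X ⊗ _ = _]/=; congr (_ ⊗ _).
by rewrite [RHS]smul_gtens //; [apply: dalg_in_deg0 | left].
Qed.

Lemma smul_hor x y k h : smul s (gtens x (inH k) : L) (gtens y (inH h)) =
  gtens (smul s x y) (inH (smul s k h)).
Proof.
have deg0 := dalg_in_deg0 GH.
by rewrite smul_gtens ?alghom_smul //; right.
Qed.

Lemma loc_hor_smul z z' : loc_hor z -> loc_hor z' -> loc_hor (smul s z z').
Proof.
have tL := tmap_lin (@idL G) inHL.
move=> [t ->] [t' ->]; exists (smul s t t').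
apply: (tens_eq_bilin (F := fun t t' => smul s (tmap id inH t : L) (tmap id inH t'))
  (G := fun t t' => tmap id inH (smul s t t'))) => [||x k y h].
- exact: (bilin_comp (smul_bilin s L) tL tL).
- exact: linear_bilin tL (smul_bilin s _).
by rewrite smul_tens !tmapE // [LHS]smul_hor.
Qed.

Lemma loc_hor_lin k z z' : loc_hor z -> loc_hor z' -> loc_hor (k *: z + z').
Proof.
move=> [t ->] [t' ->]; exists (k *: t + t').
by rewrite (tmap_lin (@idL G) inHL).
Qed.

Lemma loc_hor_in u : loc_hor (incl u).
Proof.
exists (tmap inA id u); rewrite tmap_comp //; exact: alghom_lin.
Qed.

Lemma loc_hor_base x : loc_hor (gtens x \1).
Proof. by exists (x ⊗ \1); rewrite tmapE // alghom_one. Qed.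

(** As [h] has degree 0, x ⊗ 1 and 1 ⊗ h commute, so x ⊗ h is their sided product for either value
    of [s]. The form [x] may be taken homogeneous. *)
Lemma loc_hor_ind (P : L -> Prop) :
  P 0 -> (forall z z', P z -> P z' -> P (z + z')) ->
  (forall n x u, hdeg n x -> P (smul s (gtens x \1 : L) (incl u))) ->
  forall z, loc_hor z -> P z.
Proof.
have tL := tmap_lin (@idL G) inHL.
move=> P0 PD Pg z [t ->]; elim/tens_ind: t => [|t t' h h'|x h].
- by rewrite (lin0 tL).
- by rewrite (linD tL); apply: PD.
rewrite tmapE //; elim/hdeg_ind: x => [|x x' Px Px'|n x xn].
- by rewrite (lin0 (tens_linl _)).
- by rewrite (linD (tens_linl _)); apply: PD.
suff -> : id x ⊗ inH h = smul s (gtens x \1 : L) (incl (\1 ⊗ h)) by exact: Pg xn.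
by rewrite incl_tens !alghom_one -(alghom_one inH) smul_hor smul1r smul1l.
Qed.

Section LocalAction.
Variable g : H -> tensor A H.
Hypothesis gL : linear g.

Definition loc_act (z : L) : L := tlift (fun y h => smul s y (incl (g h))) (loc_co z).

Let actB : bilin (fun (y : L) h => smul s y (incl (g h))).
Proof.
by apply: (bilin_comp (smul_bilin s L)) => //; apply: linear_comp (alghom_lin _) gL.
Qed.

Lemma loc_act_lin : linear loc_act.
Proof. exact: linear_comp (tlift_lin actB) loc_co_lin. Qed.

Lemma loc_co_base x z : loc_hor z -> loc_co (smul s (gtens x \1) z) =
  smul s ((gtens x \1 : L) ⊗ \1) (loc_co z).
Proof.
have tL : linear (tmap id inH : tensor G H -> L) by exact: tmap_lin.
move=> [t ->]; move: t.
apply: (tens_eq_lin (f := fun t => loc_co (smul s (gtens x \1 : L) (tmap id inH t)))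
  (g := fun t => smul s ((gtens x \1 : L) ⊗ \1) (loc_co (tmap id inH t)))) => [||y h].
- exact: linear_comp loc_co_lin (linear_comp (smul_linr s _) tL).
- exact: linear_comp (smul_linr s _) (linear_comp loc_co_lin tL).
rewrite tmapE // -{1}(alghom_one inH) [X in loc_co X]smul_hor smul1l.
rewrite !loc_coE rc_in !tmap_comp //.
apply: (tens_eq_lin
  (f := tmap ((gtens (smul s x y) : GH -> L) \o inH) (id \o id))
  (g := fun X => smul s ((gtens x \1 : L) ⊗ \1)
    (tmap ((gtens y : GH -> L) \o inH) (id \o id) X))) => [||k l].
- by apply: tmap_lin => //; apply: linear_comp.
- by apply: linear_comp (smul_linr s _) (tmap_lin _ _) => //; apply: linear_comp.
rewrite !tmapE //; try exact: linear_comp.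
rewrite smul_tens smul1l; congr (_ ⊗ _).
by rewrite /= -(alghom_one inH) [RHS]smul_hor smul1l.
Qed.

(** The forms x ⊗ 1 are coinvariant, and they multiply on the side opposite to the values of [g]. *)
Lemma loc_act_base x z : loc_hor z ->
  loc_act (smul s (gtens x \1) z) = smul s (gtens x \1) (loc_act z).
Proof.
move=> zh; rewrite /loc_act loc_co_base //; move: (loc_co z).
have aL := tlift_lin actB.
apply: (tens_eq_lin (f := fun Y => tlift _ (smul s ((gtens x \1 : L) ⊗ \1) Y))
  (g := fun Y => smul s (gtens x \1 : L) (tlift _ Y))) => [||y h].
- exact: linear_comp aL (smul_linr s _).
- exact: linear_comp (smul_linr s _) aL.
by rewrite smul_tens smul1l !(tliftE actB) smulA.
Qed.
End LocalAction.

(** Here [f] is a covariant derivative on the degree-0 part. The Leibniz rule fixes it on B_i ⊗ 1,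
    and its restriction to 1 ⊗ H extends to one-forms by universality; together these determine the
    projection [q]. *)
Lemma local_connection (f : tensor A H -> L) : universal GH -> linear f ->
  f \1 = 0 ->
  (forall b z, f (smul s (b ⊗ \1) z) =
     smul s (gdiff (incl (b ⊗ \1))) (incl z) + smul s (incl (b ⊗ \1)) (f z)) ->
  exists q : L -> L, [/\ linear q, forall z, loc_hor z -> q z = z &
    forall u v, q (smul s (incl u) (gdiff (incl v))) = smul s (incl u) (f v)].
Proof.
move=> GHu fL f1 fM.
have inclL : linear incl by exact: alghom_lin.
have dL : linear (@gdiff K L) by exact: gdiff_lin.
pose iota (k : H) : L := incl (\1 ⊗ k).
have iotaL : linear iota by exact: linear_comp inclL (tens_linr _).
have iotaM : {morph iota : x y / x ** y}.
  by move=> x y; rewrite /iota -alghom_mul tmulE amul1l.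
pose iotaH : alghom H L := AlgHom iotaL iotaM (alghom_one incl).
have f'L : linear (fun h : H => f (\1 ⊗ h)) by exact: linear_comp fL (tens_linr _).
have [th [thL th0 thE]] := universal_one_forms s iotaH GHu f'L f1.
(* The first summand makes the lift of [Q] the identity on horizontal forms, where [th] vanishes;
   the second prescribes it on vertical one-forms. *)
pose Q (x : G) (w : GH) : L := gtens x (gpr 0 w) + smul s (gtens x \1) (th w).
have QB : bilin Q.
  split=> [w k x x'|x k w w']; rewrite /Q.
    rewrite /gtens !(tens_linl _ k) (smul_linl s _ k) [in RHS]scalerDr.
    by rewrite addrACA.
  rewrite (gpr_lin 0) thL /gtens (tens_linr _ k) (smul_linr s _ k) [in RHS]scalerDr.
  by rewrite addrACA.
have in1 := alghom_one inH.
exists (tlift Q); split=> [|z [t ->]|u v]; first exact: tlift_lin.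
  move: t; apply: tens_eq_lin => [||x h].
  - exact: linear_comp (tlift_lin QB) (tmap_lin (@idL _) inHL).
  - exact: tmap_lin.
  by rewrite tmapE // tliftE // /Q th0 (lin0 (smul_linr s _)) addr0 dalg_in_deg0.
apply: (tens_eq_bilin (F := fun u v => tlift Q (smul s (incl u) (gdiff (incl v))))
  (G := fun u v => smul s (incl u) (f v))) => [||c k b l].
- apply: linear_bilin (tlift_lin QB) (bilin_comp (smul_bilin s L) inclL _).
  exact: linear_comp.
- exact: bilin_comp (smul_bilin s L) inclL fL.
have deg0 := dalg_in_deg0 GH; have degA := dalg_in_deg0 G.
have gs a : gsgn (inA a) = inA a by rewrite (gsgnE (degA a)) scale1r.
(* The Leibniz rule for the factorization of b ⊗ l into b ⊗ 1 and 1 ⊗ l. Its two terms match the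
   horizontal and the vertical part of the differential of b ⊗ l. *)
have fE : f (b ⊗ l) = smul s (gdiff (incl (b ⊗ \1))) (incl (\1 ⊗ l)) +
    smul s (incl (b ⊗ \1)) (f (\1 ⊗ l)).
  by rewrite -fM smul_tens smul1l smul1r.
rewrite fE !incl_tens !gdiff_tens !gs in1 alghom_one gdiff1.
have gt0 x : gtens x (0 : GH) = 0 :> L by exact: lin0 (tens_linr _).
rewrite gt0 addr0 !(linD (smul_linr s _)).
have E1 : smul s (gtens (gdiff (inA b)) \1 : L) (gtens \1 (inH l)) =
    gtens (gdiff (inA b)) (inH l).
  by rewrite -in1 smul_hor smul1l smul1r.
have E2 : smul s (gtens (inA c) (inH k) : L) (gtens (inA b) (gdiff (inH l))) =
    gtens (smul s (inA c) (inA b)) (smul s (inH k) (gdiff (inH l))).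
  by rewrite smul_gtens //; left.
have E3 X : smul s (gtens (inA c) (inH k)) (smul s (gtens (inA b) \1) X) =
    smul s (gtens (smul s (inA c) (inA b)) \1) (smul s (iotaH k) X).
  rewrite !smulA; congr (smul s _ X).
  by rewrite [iotaH k]incl_tens alghom_one -in1 !smul_hor !smul1r smul1l.
rewrite E1 E2 E3 smul_hor (linD (tlift_lin QB)) !(tliftE QB) /Q th0 thE.
rewrite deg0 (hdegE _ (hdeg_smul s (deg0 k) (gdiff_deg (deg0 l)))) gt0 add0r.
by rewrite (lin0 (smul_linr s _)) addr0.
Qed.
End LocalForms.

(** * The gauge action on horizontal forms and the conjugation of covariant derivatives *)

Section Bundle.
Variables (K : fieldType) (E : bundle K) (D : dstruct E) (s : bool).
Variable rho : Gc D -> tensor (Gc D) (bH E).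
Hypothesis rhoP : Gc_coaction rho.

Local Notation P := (bP E).
Local Notation H := (bH E).
Local Notation chi := (@bchi K E).
Local Notation Delta := (bDelta E).
Local Notation inP := (inP D).

Let idL (V : lmodType K) : linear (@id V). Proof. by []. Qed.
Let chiL i : linear (chi i). Proof. exact: alghom_lin. Qed.
Let inclL i : linear (gt_in_hom (dsB D i) (dsH D)). Proof. exact: alghom_lin. Qed.

Lemma chic_lin i : linear (@chic K E D i).
Proof. by []. Qed.

Lemma chic_smul i x y : chic i (smul s x y : Gc D) = smul s (chic i x) (chic i y).
Proof. by rewrite /smul; case: s. Qed.

Lemma chic_sum i (J : Type) (r : seq J) (F : J -> Gc D) :
  chic i (\sum_(j <- r) F j) = \sum_(j <- r) chic i (F j).
Proof. exact: (lin_sum (@chic_lin i)). Qed.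

Lemma chic_inj (x y : Gc D) : (forall i, chic i x = chic i y) -> x = y.
Proof. exact: subprod_eq. Qed.

Lemma chic_hdeg n (x : Gc D) : hdeg n x <-> forall i, hdeg n (chic i x).
Proof.
split=> [xn i|xn]; first exact: (sp_hdeg xn i).
by apply: chic_inj => i; apply: xn.
Qed.

Lemma chi0_lin i : linear (chi0 D i).
Proof. exact: alghom_lin. Qed.

Lemma inP_lin : linear inP.
Proof. by move=> k x y; apply: chic_inj => i; apply: chi0_lin. Qed.

Lemma inP_smul f x : inP (smul s f x) = smul s (inP f) (inP x).
Proof. by apply: chic_inj => i; rewrite chic_smul; apply: alghom_smul. Qed.

Lemma inP_one : inP \1 = \1.
Proof. by apply: chic_inj => i; apply: alghom_one. Qed.

Lemma hor_inP f : hor (inP f).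
Proof. by move=> i; apply: loc_hor_in. Qed.

Lemma hdeg_inP f : hdeg 0 (inP f).
Proof. by apply/chic_hdeg => i; apply: chi0_deg0. Qed.

Lemma Gc_coactionE i x : tmap (@chic K E D i) id (rho x) = loc_co (chic i x).
Proof. exact: (rhoP.2 i x). Qed.

Lemma rho_lin : linear rho.
Proof. by case: rhoP.1. Qed.

Lemma tens_chic_inj (x y : tensor (Gc D) H) :
  (forall i, tmap (@chic K E D i) id x = tmap (@chic K E D i) id y) -> x = y.
Proof.
apply: (tmap_jointly_injective (f := @chic K E D)) => [i|z z0]; first exact: chic_lin.
exact: chic_inj.
Qed.

Lemma loc_co_chi0 i f : loc_co (chi0 D i f) = tmap (chi0 D i) id (Delta f).
Proof.
rewrite loc_co_in -bchi_Delta (tmap_comp _ (@inclL i) (@idL _) (@chiL i) (@idL _)).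
by [].
Qed.

Lemma rho_inP f : rho (inP f) = tmap inP id (Delta f).
Proof.
apply: tens_chic_inj => i; rewrite Gc_coactionE loc_co_chi0.
by rewrite (tmap_comp _ (@chic_lin i) (@idL _) inP_lin (@idL _)).
Qed.

Lemma tmap_chi_inj (x y : tensor P H) :
  (forall i, tmap (chi i) id x = tmap (chi i) id y) -> x = y.
Proof.
apply: (tmap_jointly_injective (f := chi)) => [//|f f0].
by apply: (bchi_covering E).1 => i; apply: f0.
Qed.

(** Convertible to [left_act] for [s = true] and to [right_act] for [s = false]. *)
Definition act (g : H -> P) (x : Gc D) : Gc D :=
  tlift (fun y h => smul s y (inP (g h))) (rho x).

Definition unital_colinear (a : P -> P) : Prop :=
  [/\ linear a, a \1 = \1 & forall f, Delta (a f) = tmap a id (Delta f)].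

Lemma loc_act_chi_lin i (g : H -> P) : linear g ->
  linear (loc_act s (chi i \o g) : Gloc D i -> Gloc D i).
Proof. by move=> gL; apply: loc_act_lin; apply: linear_comp (@chiL i) gL. Qed.

(** By surjectivity of [chi i] the factor of degree 0 comes from [P], so that properties of a map on
    [P] can be used locally. *)
Lemma loc_hor_gen_ind i (Q : Gloc D i -> Prop) :
  Q 0 -> (forall z z', Q z -> Q z' -> Q (z + z')) ->
  (forall n x f, hdeg n x -> Q (smul s (gtens x \1 : Gloc D i) (chi0 D i f))) ->
  forall z, loc_hor z -> Q z.
Proof.
move=> Q0 QD Qg; apply: (loc_hor_ind (s := s)) => // n x u xn.
by have [f <-] := bchi_surj u; apply: Qg xn.
Qed.

Section Action.
Variables (a : P -> P) (g : H -> P).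
Hypothesis aP : unital_colinear a.
Hypothesis gL : linear g.
Hypothesis gP : forall f, a f = tlift (fun x h => smul s x (g h)) (Delta f).

Let actB : bilin (fun (y : Gc D) h => smul s y (inP (g h))).
Proof.
apply: (bilin_comp (smul_bilin s _)) => //.
exact: linear_comp inP_lin gL.
Qed.

Lemma act_lin : linear (act g).
Proof. exact: linear_comp (tlift_lin actB) rho_lin. Qed.

Lemma act_inP f : act g (inP f) = inP (a f).
Proof.
rewrite /act rho_inP (tlift_tmap _ actB inP_lin (@idL _)) gP (lin_tlift _ _ inP_lin).
by apply: eq_tlift => x h; rewrite inP_smul.
Qed.

Let chigL i : linear (chi i \o g).
Proof. exact: linear_comp (@chiL i) gL. Qed.

Lemma chic_act i x : chic i (act g x) = loc_act s (chi i \o g) (chic i x).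
Proof.
rewrite /act /loc_act -Gc_coactionE (lin_tlift _ _ (@chic_lin i)).
have B : bilin (fun (y : Gloc D i) h => smul s y (gt_in_hom _ _ ((chi i \o g) h))).
  apply: (bilin_comp (smul_bilin s (Gloc D i))) => //.
  exact: linear_comp (@inclL i) (@chigL i).
rewrite (tlift_tmap _ B (@chic_lin i) (@idL _)).
by apply: eq_tlift => y h; rewrite chic_smul.
Qed.

(** The form over the base passes through the action; on the other factor the local action is the
    image of the global one, which is [a] on [P]. *)
Lemma loc_act_gen i x f :
  loc_act s (chi i \o g) (smul s (gtens x \1 : Gloc D i) (chi0 D i f)) =
  smul s (gtens x \1 : Gloc D i) (chi0 D i (a f)).
Proof.
rewrite (loc_act_base s (@chigL i)); last exact: loc_hor_in.
by congr smul; rewrite -[chi0 D i f]/(chic i (inP f)) -chic_act act_inP.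
Qed.

Lemma act_hor x : hor x -> hor (act g x).
Proof.
move=> xh i; rewrite chic_act; have aL := @loc_act_chi_lin i _ gL.
move: (chic i x) (xh i); apply: loc_hor_gen_ind => [|z z' h h'|n y f yn].
- by rewrite (lin0 aL); exists 0; rewrite (lin0 (tmap_lin _ _)) //; apply: alghom_lin.
- rewrite (linD aL) -[loc_act _ _ z]scale1r; exact: (loc_hor_lin 1 h h').
rewrite loc_act_gen; apply: (loc_hor_smul s); first exact: loc_hor_base.
exact: loc_hor_in.
Qed.

Lemma act_hdeg n x : hor x -> hdeg n x -> hdeg n (act g x).
Proof.
move=> xh xn; apply/chic_hdeg => i; rewrite chic_act.
have aL := @loc_act_chi_lin i _ gL; pose Phi : Gloc D i -> Gloc D i := loc_act s (chi i \o g).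
(* The generators in the decomposition of a form of degree [n] may have other degrees, so the
   induction proves that the action commutes with the projection to degree [n]. *)
suff gprA (z : Gloc D i) : loc_hor z -> gpr n (Phi z) = Phi (gpr n z).
  by rewrite /hdeg gprA // (proj1 (chic_hdeg n x) xn i).
have pL := gpr_lin (d := Gloc D i) n.
move: z; rewrite {}/Phi; apply: loc_hor_gen_ind => [|z' z'' h' h''|m y f ym].
- by rewrite (lin0 pL) !(lin0 aL) (lin0 pL).
- by rewrite (linD aL) !(linD pL) (linD aL) h' h''.
have deg f' : @hdeg K (Gloc D i) m (smul s (gtens y \1 : Gloc D i) (chi0 D i f')).
  rewrite -[m]addn0; apply: (hdeg_smul s _ (chi0_deg0 D i f')).
  by rewrite -[m]addn0 /hdeg [LHS](gt_prE _ ym (hdeg_one _)) addn0 eqxx.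
rewrite loc_act_gen !(hdegE _ (deg _)); case: eqP => _; rewrite ?loc_act_gen //.
by rewrite (lin0 aL).
Qed.

Lemma act_base r x : Gm r -> hor x -> act g (smul s r x) = smul s r (act g x).
Proof.
move=> rm xh; apply: chic_inj => i; rewrite chic_act !chic_smul chic_act.
by case: (rm i) => y ->; exact: (loc_act_base s (@chigL i) y (xh i)).
Qed.

(** On a generator the factor over the base is coinvariant, which leaves the colinearity of [a] on
    [P]. *)
Lemma act_tmap x : hor x -> rho (act g x) = tmap (act g) id (rho x).
Proof.
move=> xh; apply: tens_chic_inj => i; have aL := @loc_act_chi_lin i _ gL.
rewrite Gc_coactionE chic_act (tmap_comp _ (@chic_lin i) (@idL _) act_lin (@idL _)).
transitivity (tmap (loc_act s (chi i \o g) : Gloc D i -> Gloc D i) id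
    (tmap (@chic K E D i) id (rho x))); last first.
  rewrite (tmap_comp _ aL (@idL _) (@chic_lin i) (@idL _)).
  by apply: eq_tmap => // y /=; rewrite chic_act.
rewrite Gc_coactionE.
have coL := @loc_co_lin _ _ (dsB D i) _ (dsH D); have tL := tmap_lin aL (@idL H).
move: (chic i x) (xh i); apply: loc_hor_gen_ind => [|z z' h h'|n y f yn].
- by rewrite !(lin0 aL, lin0 coL, lin0 tL).
- by rewrite !(linD aL, linD coL, linD tL) h h'.
rewrite loc_act_gen !loc_co_base; try exact: loc_hor_in.
rewrite !loc_co_chi0; case: aP => [aL' _ ->]; rewrite tmap_comp //; try exact: chi0_lin.
have caL : linear (chi0 D i \o a) by exact: linear_comp (@chi0_lin i) aL'.
apply: (tens_eq_lin
  (f := fun X => smul s ((gtens y \1 : Gloc D i) ⊗ \1) (tmap (chi0 D i \o a) id X))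
  (g := fun X => tmap (loc_act s (chi i \o g)) id
     (smul s ((gtens y \1 : Gloc D i) ⊗ \1) (tmap (chi0 D i) id X)))) => [||x' h].
- exact: linear_comp (smul_linr s _) (tmap_lin caL (@idL _)).
- apply: linear_comp tL (linear_comp (smul_linr s _) _).
  exact: tmap_lin (@chi0_lin i) (@idL _).
rewrite !tmapE //; try exact: chi0_lin.
by rewrite !smul_tens tmapE // loc_act_gen.
Qed.

Lemma act_colinear : colinear_on rho (@hor K E D) (act g).
Proof.
move=> x l xh _ rx; rewrite act_tmap // rx (lin_sum (tmap_lin act_lin (@idL H))).
by apply: eq_bigr => p _; rewrite tmapE //; apply: act_lin.
Qed.
End Action.

Lemma act_cancel a a' g g' :
  linear g -> linear g' ->
  (forall f, a f = tlift (fun x h => smul s x (g h)) (Delta f)) ->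
  (forall f, a' f = tlift (fun x h => smul s x (g' h)) (Delta f)) ->
  cancel a' a -> forall x, hor x -> act g (act g' x) = x.
Proof.
move=> gL gL' gP gP' aK x xh; apply: chic_inj => i.
rewrite (chic_act gL) (chic_act gL').
have aL := @loc_act_chi_lin i _ gL.
have aL' := @loc_act_chi_lin i _ gL'.
move: (chic i x) (xh i); apply: loc_hor_gen_ind => [|z z' h h'|n y f yn].
- by rewrite !(lin0 aL, lin0 aL').
- by rewrite !(linD aL, linD aL') h h'.
by rewrite (loc_act_gen gL' gP') (loc_act_gen gL gP) aK.
Qed.

(** Both Leibniz rules at once: the sign stands where the derivation passes the first factor, which
    is [r] for [s = true] and [x] for [s = false]. *)
Definition leibniz (d : Gc D -> Gc D) : Prop :=
  forall n r x, Gm r -> hor x -> hdeg n (if s then r else x) ->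
  d (smul s r x) = (if s then 1 else (-1) ^+ n) *: smul s (gdiff r) x +
    (if s then (-1) ^+ n else 1) *: smul s r (d x).

Lemma Gm_diff r : @Gm K E D r -> Gm (gdiff r).
Proof.
move=> rm i; case: (rm i) => x xE; exists (gdiff x).
have -> : chic i (gdiff r) = gdiff (chic i r) by [].
rewrite xE; apply: etrans (gdiff_tens _ _) _.
by rewrite gdiff1 [X in _ + X](lin0 (tens_linr _)) addr0.
Qed.

(** The action respects horizontality, degree, coaction, local kernels and multiplication by
    Gamma_m(B). In the term with [gdiff r] the two actions meet and cancel. *)
Lemma act_covder a a' g g' d :
  unital_colinear a -> unital_colinear a' ->
  linear g -> linear g' ->
  (forall f, a f = tlift (fun x h => smul s x (g h)) (Delta f)) ->
  (forall f, a' f = tlift (fun x h => smul s x (g' h)) (Delta f)) ->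
  cancel a' a -> pre_covder rho d -> leibniz d ->
  pre_covder rho (act g \o d \o act g') /\ leibniz (act g \o d \o act g').
Proof.
move=> aP aP' gL gL' gP gP' aK [dh dL ddeg [d1 dco] dker] dM.
have hh := act_hor gL gP; have hh' := act_hor gL' gP'.
split.
  split.
  - by move=> x xh; apply/hh/dh/hh'.
  - by move=> k x y xh yh /=; rewrite act_lin // dL ?act_lin //; apply: hh'.
  - move=> n x xh xn; apply: act_hdeg gL gP _ _ _ _; first exact/dh/hh'.
    by apply: ddeg; [apply: hh' | apply: act_hdeg gL' gP' _ _ _ _].
  - split.
      rewrite /= -{1}inP_one (act_inP gL' gP'); case: aP' => _ -> _.
      by rewrite inP_one d1 (lin0 (act_lin gL)).
    move=> x l xh lh rx /=.
    (* Colinearity refers to expansions with horizontal entries; that of [rho x] is carried through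
       the three maps in turn, and [map1] keeps its entries horizontal. *)
    have map1 (f : Gc D -> Gc D) (l' : seq (Gc D * H)) : (forall p, p \in l' -> hor p.1) ->
        (forall y, hor y -> hor (f y)) ->
        forall p, p \in [seq (f q.1, q.2) | q <- l'] -> hor p.1.
      by move=> lh' fh p /mapP[q /lh' qh ->]; apply: fh.
    have e1 := act_colinear aP' gL' gP' xh lh rx.
    have lh1 := map1 _ _ lh hh'.
    rewrite -(big_map (fun q => (act g' q.1, q.2)) xpredT (fun p => p.1 ⊗ p.2)) in e1.
    have e2 := dco _ _ (hh' _ xh) lh1 e1.
    rewrite -(big_map (fun q => (d q.1, q.2)) xpredT (fun p => p.1 ⊗ p.2)) in e2.
    rewrite (act_colinear aP gL gP (dh _ (hh' _ xh)) (map1 _ _ lh1 dh) e2).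
    by rewrite !big_map.
  - move=> i x xh x0 /=; rewrite (chic_act gL) dker ?(lin0 (@loc_act_chi_lin i _ gL)) //.
      exact: hh'.
    by rewrite (chic_act gL') x0 (lin0 (@loc_act_chi_lin i _ gL')).
move=> n r x rm xh rxn /=; rewrite act_base // (dM n) //; last first.
(* In the right rule [n] is the degree of [x], which the action preserves. *)
- by move: rxn; case: (s) => // xn; apply: act_hdeg gL' gP' _ _ _ _.
- exact: hh'.
rewrite (linD (act_lin gL)) !(linZ (act_lin gL)).
have rm' := Gm_diff rm.
rewrite !act_base //; try by [apply: hh' | apply/dh/hh'].
by rewrite (act_cancel gL gL' gP gP' aK).
Qed.
End Bundle.

(** * Gauge transformations and their inverses are unital and colinear *)

Section GaugeColinear.
Variables (K : fieldType) (E : bundle K).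
Local Notation P := (bP E).
Local Notation chi := (@bchi K E).
Local Notation Delta := (bDelta E).

Let idL (V : lmodType K) : linear (@id V). Proof. by []. Qed.

(** Both identities may be tested after every [chi i]: the kernels meet in 0, and this persists
    after tensoring with the Hopf algebra. *)
Lemma local_unital_colinear (a : P -> P) : linear a ->
  (forall i, exists ai, [/\ linear ai, ai \1 = \1,
     forall x, tmap ai id (id_tens (@cop K (bH E)) x) = id_tens (@cop K (bH E)) (ai x) &
     forall f, chi i (a f) = ai (chi i f)]) ->
  unital_colinear a.
Proof.
move=> aL aloc; have chiL i : linear (chi i) by exact: alghom_lin.
split=> // [|f].
  apply/eqP; rewrite -subr_eq0; apply/eqP; apply: (bchi_covering E).1 => i.
  case: (aloc i) => ai [_ ai1 _ aiE]; rewrite /= /ker_set (linB (@chiL i)) aiE.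
  by rewrite alghom_one ai1 subrr.
apply: tmap_chi_inj => i; case: (aloc i) => ai [aiL _ aiD aiE].
rewrite bchi_Delta aiE -aiD -bchi_Delta.
rewrite (tmap_comp _ aiL (@idL _) (@chiL i) (@idL _)).
rewrite (tmap_comp _ (@chiL i) (@idL _) aL (@idL _)).
by apply: eq_tmap => // x; rewrite /= aiE.
Qed.

Lemma left_gauge_unital_colinear (a : P -> P) : left_gauge a -> unital_colinear a.
Proof.
move=> [aL _ _ aloc]; apply: local_unital_colinear => // i.
by case: (aloc i) => ai [aiL _ _ aiD ai1] aiE; exists ai; split=> //; apply: ai1.
Qed.

Lemma right_gauge_unital_colinear (a : P -> P) : right_gauge a -> unital_colinear a.
Proof.
move=> [aL _ _ aloc]; apply: local_unital_colinear => // i.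
by case: (aloc i) => ai [aiL _ _ aiD ai1] aiE; exists ai; split=> //; apply: ai1.
Qed.

Lemma inverse_unital_colinear (a a' : P -> P) :
  cancel a a' -> cancel a' a -> unital_colinear a -> unital_colinear a'.
Proof.
move=> aK a'K [aL a1 aD].
have a'L : linear a'.
  by move=> k x y; apply: (can_inj aK); rewrite aL !a'K.
split=> // [|f]; first by rewrite -a1 aK.
rewrite -{2}(a'K f) aD (tmap_comp _ a'L (@idL _) aL (@idL _)).
by rewrite -[LHS]tmap_id; apply: eq_tmap => // x; rewrite /= aK.
Qed.
End GaugeColinear.

(** * The connection belonging to a covariant derivative *)

Section Connection.
Variables (K : fieldType) (E : bundle K) (D : dstruct E) (s : bool).
Variable rho : Gc D -> tensor (Gc D) (bH E).
Hypothesis rhoP : Gc_coaction rho.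

Local Notation P := (bP E).
Local Notation H := (bH E).
Local Notation chi := (@bchi K E).
Local Notation Delta := (bDelta E).
Local Notation inP := (inP D).
Local Notation L := (Gloc D).

Let idL (V : lmodType K) : linear (@id V). Proof. by []. Qed.

Lemma chiG_qproj i (y : dsOm D) : chiG D i (qproj _ y) = chiOm D i y.
Proof. by apply: (qliftE (f := chiOm D i)) => z Jz; apply: Jz. Qed.

Lemma chiOm_in i f : chiOm D i (dalg_in (dsOm D) f) = chi0 D i f.
Proof. by rewrite /chiOm /udalg_ext; case: (cid _). Qed.

(** The expansion is taken in Omega(P), hence is the same for all [i]; the glueing rests on this. *)
Lemma GP_one_form (x : GP D) : hdeg 1 x -> exists l : seq (P * P),
  forall i, chiG D i x = \sum_(p <- l) smul s (chi0 D i p.1) (gdiff (chi0 D i p.2)).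
Proof.
move=> /q_hdeg[y y1 ->]; case: (hdeg1_one_form s y1) => l yE; exists l => i.
rewrite chiG_qproj yE (lin_sum (alghom_lin _)); apply: eq_bigr => p _.
by rewrite alghom_smul dgahom_d !chiOm_in.
Qed.

(** Only the single component [chic i x] is lifted to Gamma(P), so here the expansion depends on
    [i]. *)
Lemma Gc_one_form i (x : Gc D) : hdeg 1 x -> exists l : seq (P * P),
  chic i x = \sum_(p <- l) smul s (chi0 D i p.1) (gdiff (chi0 D i p.2)).
Proof.
move=> x1; case: (spfamP x i i) => y [_ [yE _ _]].
have [|l lE] := @GP_one_form (gpr 1 y); first exact: hdeg_gpr.
by exists l; rewrite -lE dgahom_pr yE; apply/esym; apply: (proj1 (chic_hdeg 1 x) x1 i).
Qed.

Variable d : Gc D -> Gc D.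
Hypothesis GHu : universal (dsH D).
Hypothesis dP : pre_covder rho d.
Hypothesis dM : leibniz s d.

(** A preimage in [P] is chosen; another choice changes it by an element of the kernel of [chi i],
    and [d] respects local kernels. *)
Definition loc_covder i (z : tensor (quotient (@bJ K E i)) H) : L i :=
  chic i (d (inP (sval (cid (bchi_surj z))))).

Lemma loc_covderE i f : loc_covder (chi i f) = chic i (d (inP f)).
Proof.
case: dP => _ dL _ _ dker.
rewrite /loc_covder; case: cid => f' /= f'E; apply/eqP; rewrite -subr_eq0; apply/eqP.
have hor_f := @hor_inP K E D.
have -> : chic i (d (inP f')) - chic i (d (inP f)) = chic i (d (-1 *: inP f + inP f')).
  by rewrite dL // chic_lin scaleN1r addrC.
rewrite -(inP_lin D) dker //.
have -> : chic i (inP (-1 *: f + f')) = chi0 D i (-1 *: f + f') by [].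
rewrite chi0_lin scaleN1r /chi0 /= f'E; exact: addNr.
Qed.

Lemma loc_covder_lin i : linear (@loc_covder i).
Proof.
case: dP => _ dL _ _ _ k z z'.
have [f <-] := bchi_surj z; have [f' <-] := bchi_surj z'.
rewrite -alghom_lin !loc_covderE (inP_lin D) dL ?chic_lin //; exact: hor_inP.
Qed.

(** Lifting [b] to the base algebra and [z] to [P] reduces this to the Leibniz rule of [d]. Both
    lifts have degree 0, so neither side produces a sign. *)
Lemma loc_covder_leibniz i (b : quotient (@bJ K E i)) z :
  loc_covder (smul s (b ⊗ \1) z) =
  smul s (gdiff (gt_in_hom _ _ (b ⊗ \1))) (gt_in_hom _ _ z) +
  smul s (gt_in_hom _ _ (b ⊗ \1)) (loc_covder z).
Proof.
have [f <-] := bchi_surj z; have [b' ->] := Defs.quotP b.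
rewrite -bchi_iota -alghom_smul !loc_covderE inP_smul.
have bm : Gm (inP (biota E b')).
  move=> j; exists (dalg_in (dsB D j) (qproj (bJ j) b')).
  rewrite -(alghom_one (dalg_in (dsH D))) -[RHS]incl_tens -bchi_iota //.
have deg0 : hdeg 0 (if s then inP (biota E b') else inP f).
  by case: (s); apply: hdeg_inP.
rewrite (dM bm (hor_inP D f) deg0) !expr0 !if_same !scale1r.
by rewrite (linD (@chic_lin _ _ D i)) !chic_smul.
Qed.

Lemma local_projections : exists q : forall i, L i -> L i, forall i,
  [/\ linear (q i), forall z, loc_hor z -> q i z = z &
    forall f h, q i (smul s (chi0 D i f) (gdiff (chi0 D i h))) =
      smul s (chi0 D i f) (chic i (d (inP h)))].
Proof.
have ex i : exists q : L i -> L i, [/\ linear q, forall z, loc_hor z -> q z = z &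
    forall f h, q (smul s (chi0 D i f) (gdiff (chi0 D i h))) =
      smul s (chi0 D i f) (chic i (d (inP h)))].
  have [|q [qL qh qE]] := local_connection GHu (@loc_covder_lin i) _ (@loc_covder_leibniz i).
    case: dP => _ _ _ [d1 _] _.
    by rewrite -(alghom_one (chi i)) loc_covderE inP_one d1.
  exists q; split=> // f h; rewrite -loc_covderE; exact: qE.
by exists (fun i => sval (cid (ex i))) => i; case: cid.
Qed.

(** * Glueing the local projections *)

Section Glueing.
Variable q : forall i, L i -> L i.
Arguments q : clear implicits.
Hypothesis qP : forall i,
  [/\ linear (q i), forall z, loc_hor z -> q i z = z &
    forall f h, q i (smul s (chi0 D i f) (gdiff (chi0 D i h))) =
      smul s (chi0 D i f) (chic i (d (inP h)))].

Let qL i : linear (q i).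
Proof. by case: (qP i). Qed.

(** The value that the connection has to take on the one-form with expansion [l]. Being an element
    of Gamma_c(P), it has compatible local components. *)
Definition transport (l : seq (P * P)) : Gc D :=
  \sum_(p <- l) smul s (inP p.1) (d (inP p.2)).

Lemma q_one_form i l :
  q i (\sum_(p <- l) smul s (chi0 D i p.1) (gdiff (chi0 D i p.2))) =
  chic i (transport l).
Proof.
rewrite (lin_sum (@qL i)) chic_sum; apply: eq_bigr => p _.
by case: (qP i) => _ _ ->; rewrite chic_smul.
Qed.

(** Lifts of the components of [x] at [i] and [j] to Gamma(P) differ by an element of K_i + K_j.
    Expanding the lifts over [P] expresses the projections by values of [transport], which are
    compatible. The projection to degree 1 extends the family to all [x]. *)
Lemma Gc_compat_q (x : Gc D) : Gc_compat (fun i => q i (gpr 1 (chic i x))).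
Proof.
move=> i j; case: (spfamP (gpr 1 x) i j) => y [z [yE zE yz]].
have gpr_idem k : gpr 1 (chic k (gpr 1 x)) = chic k (gpr 1 x).
  exact: hdeg_gpr.
have [u [v [Ku Kv uvE]]] : sum_ideal (KP D i) (KP D j) (gpr 1 (y - z)).
  by apply: (@dgideal_pr _ _ (sum_dgideal (KP D i) (KP D j))); apply/qprojP.
have lift w : exists l, forall k, q k (chiG D k (gpr 1 w)) = chic k (transport l).
  have [l lE] := @GP_one_form (gpr 1 w) (hdeg_gpr 1 w).
  by exists l => k; rewrite lE q_one_form.
have [ly lyE] := lift y; have [lu luE] := lift u.
have chi_y : q i (gpr 1 (chic i x)) = chic i (transport ly).
  by rewrite -lyE dgahom_pr yE; congr (q i _); apply/esym/gpr_idem.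
have Kpr k w : KP D k w -> chiG D k (gpr 1 w) = 0.
  by move=> Kw; apply: (dgideal_pr (d := KP D k) 1 Kw).
have ui : chic i (transport lu) = 0 by rewrite -luE Kpr // (lin0 (@qL i)).
(* At [j] the part [v] of the difference of the lifts vanishes and [u] remains, while at [i] it is
   [u] that vanishes. *)
have chi_z : q j (gpr 1 (chic j x)) = chic j (transport ly) - chic j (transport lu).
  rewrite -lyE -luE -(linB (@qL j)) -(linB (alghom_lin _)); congr (q j _).
  have -> : gpr 1 (chic j x) = chiG D j (gpr 1 z).
    by rewrite dgahom_pr zE; apply/esym/gpr_idem.
  have yzE : gpr 1 y - gpr 1 z = gpr 1 u + gpr 1 v.
    by rewrite -!(linD (gpr_lin _), linB (gpr_lin _)) -uvE (hdeg_gpr 1).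
  have -> : gpr 1 z = gpr 1 y - gpr 1 u - gpr 1 v.
    by rewrite -addrA -opprD -yzE opprB addrC subrK.
  by rewrite [LHS](linB (alghom_lin _)) (Kpr j v) // subr0.
have [Y1 [Y2 [Y1E Y2E Y12]]] := spfamP (transport ly) i j.
have [U1 [U2 [U1E U2E U12]]] := spfamP (transport lu) i j.
exists Y1, (Y2 - U2); split; first by rewrite chi_y.
  by rewrite chi_z (linB (alghom_lin _)) Y2E U2E.
apply/qprojP; rewrite opprB addrCA addrC.
apply: idealD; first exact/qprojP.
(* [U1] lifts [chic i (transport lu)], which is 0, so it lies in K_i, and [U2] differs from it by an
   element of K_i + K_j. *)
have -> : U2 = U1 - (U1 - U2) by rewrite opprB addrC subrK.
apply: idealB; last exact/qprojP.
exists U1, 0; split; [by rewrite /= /ker_set U1E | exact: ideal0 | by rewrite addr0].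
Qed.

Definition glue (x : Gc D) : Gc D := SubProd (S := Gc_sub D) (Gc_compat_q x).

Lemma chic_glue i x : hdeg 1 x -> chic i (glue x) = q i (chic i x).
Proof. by move=> x1; congr (q i _); apply: (proj1 (chic_hdeg 1 x) x1 i). Qed.

Lemma glue_one_form i x : hdeg 1 x -> exists l, chic i (glue x) = chic i (transport l).
Proof.
move=> x1; have [l lE] := Gc_one_form i x1; exists l.
by rewrite chic_glue // lE q_one_form.
Qed.

Lemma transport_hor l : hor (transport l).
Proof.
case: dP => dh _ _ _ _ i.
rewrite chic_sum; elim: l => [|p l IH].
  by rewrite big_nil; exists 0; rewrite (lin0 (tmap_lin _ _)) //; apply: alghom_lin.
rewrite big_cons -[X in X + _]scale1r; apply: loc_hor_lin IH.
rewrite chic_smul; apply: loc_hor_smul; first exact: loc_hor_in.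
by apply: dh; apply: hor_inP.
Qed.

Lemma transport_hdeg l : hdeg 1 (transport l).
Proof.
case: dP => _ _ dd _ _; rewrite /transport; elim: l => [|p l IH].
  by rewrite big_nil; apply: hdeg0.
rewrite big_cons; apply: hdegD IH; apply: (hdeg_smul s (hdeg_inP D p.1)).
by apply: dd; [apply: hor_inP | apply: hdeg_inP].
Qed.

(** On a product of a function and a differential the coaction is multiplicative and commutes with
    the differential, so the claim reduces to the colinearity of [d] on [P]. *)
Lemma glue_colinear_local i l :
  loc_co (q i (\sum_(p <- l) smul s (chi0 D i p.1) (gdiff (chi0 D i p.2)))) =
  tmap (q i) id (loc_co (\sum_(p <- l) smul s (chi0 D i p.1) (gdiff (chi0 D i p.2)))).
Proof.
have coL := @loc_co_lin _ _ (dsB D i) _ (dsH D).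
have tqL := tmap_lin (@qL i) (@idL H).
rewrite (lin_sum (@qL i)) !(lin_sum coL) (lin_sum tqL); apply: eq_bigr => p _.
move: p.1 p.2 => {p} f h; case: (qP i) => _ _ qE; rewrite qE.
have rho_d : rho (d (inP h)) = tmap (d \o inP) id (Delta h).
  case: dP => _ _ _ [_ dco] _.
  rewrite (dco (inP h) [seq (inP p.1, p.2) | p <- repr (Delta h)]) ?big_map //.
  - exact: hor_inP.
  - by move=> p /mapP[p' _ ->]; apply: hor_inP.
  by rewrite (rho_inP rhoP).
rewrite ![loc_co (smul _ _ _)](loc_co_smul s (chi i f)) loc_co_d.
rewrite -[gt_in_hom _ _ (chi i f)]/(chi0 D i f) !loc_co_chi0.
rewrite -(Gc_coactionE rhoP) rho_d.
have dinL : linear (d \o inP).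
  case: dP => _ dL _ _ _ k x y /=.
  by rewrite (inP_lin D) dL //; apply: hor_inP.
have diL : linear ((gdiff : L i -> L i) \o chi0 D i).
  exact: linear_comp (@gdiff_lin _ _) (@chi0_lin _ _ D i).
have cdL : linear (@chic _ _ D i \o (d \o inP)).
  exact: linear_comp (@chic_lin _ _ D i) dinL.
rewrite (tmap_comp _ (@chic_lin _ _ D i) (@idL _) dinL (@idL _)).
rewrite (tmap_comp _ (@gdiff_lin _ _) (@idL _) (@chi0_lin _ _ D i) (@idL _)).
have c0L := tmap_lin (@chi0_lin _ _ D i) (@idL H).
apply: (tens_eq_bilin
  (F := fun X Y => smul s (tmap (chi0 D i) id X) (tmap (@chic _ _ D i \o (d \o inP)) id Y))
  (G := fun X Y => tmap (q i) id
    (smul s (tmap (chi0 D i) id X) (tmap ((gdiff : L i -> L i) \o chi0 D i) id Y))))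
  => [||x k y m].
- exact: bilin_comp (smul_bilin s _) c0L (tmap_lin cdL (@idL _)).
- apply: linear_bilin tqL _.
  exact: bilin_comp (smul_bilin s _) c0L (tmap_lin diL (@idL _)).
rewrite (tmapE _ _ (@chi0_lin _ _ D i) (@idL _)) (tmapE _ _ cdL (@idL _)).
rewrite (tmapE _ _ diL (@idL _)) !smul_tens (tmapE _ _ (@qL i) (@idL _)).
by congr (_ ⊗ _); exact: esym (qE x y).
Qed.

Lemma glue_connection : [/\ pre_connection rho glue,
  forall f x, hdeg 1 x -> glue (smul s (inP f) x) = smul s (inP f) (glue x) &
  forall f, d (inP f) = glue (gdiff (inP f))].
Proof.
have chic1 i x : hdeg 1 x -> hdeg 1 (chic i x) by move=> /chic_hdeg; apply.
have glueL x y k : hdeg 1 x -> hdeg 1 y -> glue (k *: x + y) = k *: glue x + glue y.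
  move=> x1 y1; apply: chic_inj => i.
  have xy1 : hdeg 1 (k *: x + y) by apply: hdegD y1; apply: hdegZ.
  by rewrite chic_lin !chic_glue // chic_lin qL.
split.
- split=> [k x y x1 y1|x x1|x [xh x1]|x l x1 l1 rx|i x x1 x0]; first exact: glueL.
  + split=> [i|].
      by have [l ->] := glue_one_form i x1; apply: transport_hor.
    apply/chic_hdeg => i; have [l ->] := glue_one_form i x1.
    by apply: chic1; apply: transport_hdeg.
  + apply: chic_inj => i; rewrite chic_glue //.
    by case: (qP i) => _ -> //; apply: xh.
  + apply: (tens_chic_inj (D := D)) => i.
    have cL := tmap_lin (@chic_lin _ _ D i) (@idL H).
    rewrite (Gc_coactionE rhoP) chic_glue //.
    have [t tE] := Gc_one_form i x1; rewrite tE glue_colinear_local -tE.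
    rewrite -(Gc_coactionE rhoP) rx !(lin_sum cL) (lin_sum (tmap_lin (@qL i) (@idL _))).
    (* Membership in [l] is recorded because [chic_glue] needs the entries to have degree 1. *)
    rewrite big_seq [RHS]big_seq; apply: eq_bigr => p /l1 p1.
    rewrite !(tmapE _ _ (@chic_lin _ _ D i) (@idL _)) (tmapE _ _ (@qL i) (@idL _)).
    by rewrite chic_glue.
  + by rewrite chic_glue // x0 (lin0 (@qL i)).
- move=> f x x1; apply: chic_inj => i.
  have fx1 : hdeg 1 (smul s (inP f) x) by apply: (hdeg_smul s (hdeg_inP D f)).
  rewrite chic_smul !chic_glue // chic_smul.
  have [l ->] := Gc_one_form i x1.
  rewrite (lin_sum (smul_linr s _)) !(lin_sum (@qL i)) (lin_sum (smul_linr s _)).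
  apply: eq_bigr => p _; case: (qP i) => _ _ qE.
  rewrite smulA -[chic i (inP f)]/(chi0 D i f) -alghom_smul !qE alghom_smul.
  by rewrite -smulA.
- move=> f; apply: chic_inj => i.
  rewrite chic_glue; last exact: gdiff_deg (hdeg_inP D f).
  have -> : chic i (gdiff (inP f)) = smul s (chi0 D i \1) (gdiff (chi0 D i f)).
    by rewrite alghom_one smul1l.
  by case: (qP i) => _ _ ->; rewrite alghom_one smul1l.
Qed.
End Glueing.

(** The converse, for universal Gamma(H), of the passage from a connection to its covariant
    derivative. *)
Lemma covder_connection : exists p, [/\ pre_connection rho p,
  forall f x, hdeg 1 x -> p (smul s (inP f) x) = smul s (inP f) (p x) &
  forall f, d (inP f) = p (gdiff (inP f))].
Proof. by have [q qP] := local_projections; exists (glue qP); apply: glue_connection. Qed.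
End Connection.

Theorem proposition10 (R : realType) (E : bundle R[i]) (D : dstruct E)
    (rho : Gc D -> tensor (Gc D) (bH E))
    (rhoP : Gc_coaction rho)
    (antipode_bij : bijective (@antipode R[i] (bH E)))
    (GH_universal : universal (dsH D)) :
  (forall (p d : Gc D -> Gc D) (a a' : bP E -> bP E) (g g' : bH E -> bP E),
     left_connection rho p -> left_covder_of rho p d ->
     left_gauge a -> cancel a a' -> cancel a' a ->
     left_gauge_map a g -> left_gauge_map a' g' ->
     exists2 p', left_connection rho p' &
       left_covder_of rho p' (left_act rho g \o d \o left_act rho g'))
  /\
  (forall (p d : Gc D -> Gc D) (a a' : bP E -> bP E) (g g' : bH E -> bP E),
     right_connection rho p -> right_covder_of rho p d ->
     right_gauge a -> cancel a a' -> cancel a' a ->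
     right_gauge_map a g -> right_gauge_map a' g' ->
     exists2 p', right_connection rho p' &
       right_covder_of rho p' (right_act rho g \o d \o right_act rho g')).
Proof.
split=> p d a a' g g' _ [[dP dM] _].
- move=> /left_gauge_unital_colinear aP aK a'K [gL gE] [g'L g'E].
  have a'P := inverse_unital_colinear aK a'K aP.
  have dM' : leibniz true d by move=> n r x rm xh rn; rewrite (dM n) // scale1r.
  have [eP eM] := act_covder (s := true) rhoP aP a'P gL g'L gE g'E a'K dP dM'.
  (* The new projection is constructed from the conjugated derivative, now known to be a covariant
     derivative. *)
  have [p' [pP pM pE]] := covder_connection rhoP GH_universal eP eM.
  exists p'; split=> //; split=> // n r x rm rn xh.
  by rewrite [LHS](eM n r x rm xh rn) scale1r.
- move=> /right_gauge_unital_colinear aP aK a'K [gL gE] [g'L g'E].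
  have a'P := inverse_unital_colinear aK a'K aP.
  have dM' : leibniz false d.
    by move=> n r x rm xh xn; rewrite (dM n) // scale1r addrC.
  have [eP eM] := act_covder (s := false) rhoP aP a'P gL g'L gE g'E a'K dP dM'.
  have [p' [pP pM pE]] := covder_connection rhoP GH_universal eP eM.
  exists p'; split=> //; split=> // n r x rm xh xn.
  by rewrite [LHS](eM n r x rm xh xn) scale1r addrC.
Qed.
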